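(* Let $d\in\mathbb{N}$, let $p:\mathbb{Z}^d\to[0,1)$ satisfy $\sum_x p(x)=1$, $p(x)=0$ for $|x|>M$ for some $M<\infty$, and strong aperiodicity (for every $u\in\mathbb{Z}^d$ the smallest additive subgroup of $\mathbb{Z}^d$ containing $\{u+x:p(x)>0\}$ is $\mathbb{Z}^d$). Let $\xi=\{\xi_t(x)\}_{t\in\mathbb{Z},x\in\mathbb{Z}^d}$ be i.i.d. real with mean zero and variance $\sigma_\xi^2<\infty$. Consider the height process on $\mathbb{R}^{\mathbb{Z}^d}$, $h_{t+1}(x)=\sum_y p(x,y)h_t(y)+\xi_{t+1}(x)$, with $\xi_{t+1}$ independent of $h_t$. (a) If $d\in\{1,2\}$, this Markov chain has no invariant distribution (no probability measure on $\mathbb{R}^{\mathbb{Z}^d}$ is preserved by the evolution). (b) If $d\ge 3$, then the series $\chi_t(x)=\sum_{k=0}^\infty\sum_{z\in\mathbb{Z}^d}\xi_{t-k}(z)p^k(x,z)$, $x\in\mathbb{Z}^d$, $t\in\mathbb{Z}$, converges for almost every $\xi$ and in $L^2(\mathbb{P})$; for almost every $\xi$ the variables $\chi_t(x)$ satisfy $\chi_{t+1}(x)=\sum_yp(x,y)\chi_t(y)+\xi_{t+1}(x)$ for all $t,x$; the process $\{\chi_t\}_{t\in\mathbb{Z}}$ is a stationary version of the height Markov chain, and the field $\{\chi_t(x)\}_{t\in\mathbb{Z},x\in\mathbb{Z}^d}$ is invariant and ergodic under each individual space-time shift $\theta_{x,t}$ with $(x,t)\neq(0,0)$.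
   Context: $p(x,y)=p(y-x)$ and $p^k$ is the $k$-step transition probability. $\mathbb{P}$ is the law of $\xi$. The space-time shift acts by $(\theta_{x,t}\omega)_s(y)=\omega_{s+t}(y+x)$.
   Formalization: Part (a) additionally assumes that the variance of ξ is strictly positive; with zero variance the noise vanishes and the point mass at the zero field is invariant, so (a) would be false. *)

(* Defs.v *)
From HB Require Import structures.
From mathcomp Require Import all_boot all_order all_algebra.
From mathcomp Require Import finmap.
From mathcomp Require Import all_classical all_reals all_analysis.
Set Implicit Arguments. Unset Strict Implicit. Unset Printing Implicit Defensive.
Import Order.TTheory GRing.Theory Num.Theory.
Import numFieldNormedType.Exports.
Local Open Scope classical_set_scope.
Local Open Scope ring_scope.

Definition norm_gt (d : nat) (M : nat) (x : 'rV[int]_d) : Prop :=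
  exists i : 'I_d, (M%:Z < `|x ord0 i|)%R.

Definition strongly_aperiodic (d : nat) (R : realType) (p : 'rV[int]_d -> R) : Prop :=
  forall (u : 'rV[int]_d) (G : set 'rV[int]_d),
    G 0 -> (forall a b, G a -> G b -> G (a - b)) ->
    (forall x, 0 < p x -> G (u + x)) -> G = setT.

(* k-step transition probability p^k(x,z), with p(x,y) = p(y - x). *)
Fixpoint pk (d : nat) (R : realType) (p : 'rV[int]_d -> R) (k : nat)
    (x z : 'rV[int]_d) : R :=
  match k with
  | 0 => (x == z)%:R
  | k'.+1 => \sum_(y \in [set: 'rV[int]_d]) p (y - x) * pk p k' y z
  end.

Definition avg (d : nat) (R : realType) (p : 'rV[int]_d -> R)
    (h : 'rV[int]_d -> R) (x : 'rV[int]_d) : R :=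
  \sum_(y \in [set: 'rV[int]_d]) p (y - x) * h y.

Definition prod_sigma (I : Type) (R : realType) : set (set (I -> R)) :=
  <<s \bigcup_(i in [set: I])
        [set (fun f : I -> R => f i) @^-1` B | B in [set B : set R | measurable B]] >>.

Definition gen_sigma (Omega : Type) (R : realType) (I : Type)
    (X : I -> Omega -> R) (S : set I) : set (set Omega) :=
  <<s \bigcup_(i in S) [set X i @^-1` B | B in [set B : set R | measurable B]] >>.

Definition indep_family (dO : measure_display) (Omega : measurableType dO)
    (R : realType) (P : probability Omega R) (I : choiceType)
    (F : I -> set (set Omega)) : Prop :=
  forall (J : {fset I}) (A : I -> set Omega),
    (forall j, j \in J -> F j (A j)) ->
    P (\bigcap_(j in [set` J]) A j) = (\prod_(j <- J) P (A j))%E.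

Definition indep2 (dO : measure_display) (Omega : measurableType dO)
    (R : realType) (P : probability Omega R) (F G : set (set Omega)) : Prop :=
  forall A B, F A -> G B -> P (A `&` B) = (P A * P B)%E.

Definition iid (dO : measure_display) (Omega : measurableType dO)
    (R : realType) (P : probability Omega R) (I : choiceType)
    (X : I -> Omega -> R) : Prop :=
  [/\ forall i, measurable_fun setT (X i),
      indep_family P (fun i => gen_sigma X [set i]) &
      forall i j (B : set R), measurable B -> P (X i @^-1` B) = P (X j @^-1` B)].

Definition Spart (d : nat) (R : realType) (Omega : Type) (p : 'rV[int]_d -> R)
    (xi : int -> 'rV[int]_d -> Omega -> R) (n : nat) (t : int)
    (x : 'rV[int]_d) (w : Omega) : R :=
  \sum_(k < n) \sum_(z \in [set: 'rV[int]_d]) xi (t - k%:Z) z w * pk p k x z.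

Definition chi (d : nat) (R : realType) (Omega : Type) (p : 'rV[int]_d -> R)
    (xi : int -> 'rV[int]_d -> Omega -> R) (t : int) (x : 'rV[int]_d)
    (w : Omega) : R :=
  if pselect (cvgn (fun n => Spart p xi n t x w))
  then limn (fun n => Spart p xi n t x w) else 0.

Definition st_shift (d : nat) (R : Type) (x : 'rV[int]_d) (t : int)
    (f : int * 'rV[int]_d -> R) : int * 'rV[int]_d -> R :=
  fun sy => f (sy.1 + t, sy.2 + x).

(* Main.v *)
(* Everything rests on the collision sum [q_k = sum_z p^k(0,z)^2], the return
   probability of the difference of two independent walks.

   In dimensions one and two the sum of the [q_k] diverges: by Chebyshev's
   inequality half of the mass of [p^k] lies in a box with O(k^(d/2)) points,
   hence [q_k >= c / k].  If the law of [h] were invariant, iterating the evolution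
   would give [h(0) = (P^n h)(0) + sum_(k < n) (P^k xi_k)(0)] in law, with independent
   terms.  The characteristic function of [xi] satisfies [|f(u)|^2 <= 1 - c u^2] near
   0, so that of [h(0)] satisfies [|g(u)|^2 <= exp(- c u^2 sum_(k < n) q_k)] for every
   [n], and would vanish for all small [u > 0], contradicting its continuity at 0.

   In dimension at least three the sum of the [q_k] converges.  Its partial sums
   are the values at 0 of the truncated Green functions [G] of the difference walk,
   whose Dirichlet energy is at most [2 G(0)].  By aperiodicity this energy
   dominates that of the simple walk, and testing [G] against a unit flow of finite
   energy from 0 to infinity, that of Polya's urn with three colours, gives
   [G(0)^2 <= C G(0)].  The terms of the series [chi] are then independent and
   centred with summable variances, and Kolmogorov's maximal inequality applies.
   Finally [chi] is an equivariant measurable function of the noise, which is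
   invariant and mixing under every nontrivial shift. *)

Require Import Defs.
From HB Require Import structures.
From mathcomp Require Import all_boot all_order all_algebra.
From mathcomp Require Import finmap.
From mathcomp Require Import all_classical all_reals all_analysis.
From mathcomp Require Import measurable_realfun.
From mathcomp Require Import ring lra zify.
Set Implicit Arguments. Unset Strict Implicit. Unset Printing Implicit Defensive.
Import Order.TTheory GRing.Theory Num.Theory.
Import numFieldNormedType.Exports.
Local Open Scope classical_set_scope.
Local Open Scope ring_scope.

(** * Finitely supported functions and the random walk *)

(** The two regimes ask for different information. Divergence needs a lower bound on each q_k, and a
    count of lattice points gives it. Convergence needs a bound on the partial sums that is uniform
    in their length. Truncating the Green function keeps it finitely supported, so that summation by
    parts has no boundary term. The energy bound is linear in G(0) and the bound by the flow is
    quadratic, so that together they bound G(0) whatever the truncation. The flow has to be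
    explicit. That of the urn is uniform on each level, so the total flow into a point and the total
    flow out of it are rational functions of the level, and the energy is dominated by a series that
    telescopes in each of the three coordinates. An invariant law of h may have no moments, so
    variances cannot be compared. Characteristic functions exist without moments, and their squared
    moduli are multiplicative over independent sums and at most 1, so the factor of P^n h can be
    discarded. Continuity at 0 is then the only property of h(0) that is contradicted. *)

Section FiniteSupport.
Variables (R : realType) (I : choiceType).
Implicit Types f g : I -> R.

(** A sum over all of [I] is 0 by convention when the support is infinite. Linearity, monotonicity
    and exchange of sums therefore carry this predicate as a side condition. *)
Definition fin_supp f := exists r : seq I, forall x, f x != 0 -> x \in r.

Lemma fsum_seq (r : seq I) f : uniq r -> (forall x, f x != 0 -> x \in r) ->
  \sum_(x \in [set: I]) f x = \sum_(x <- r) f x.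
Proof.
move=> ur fr; rewrite (@fsbigE _ _ _ _ _ r)//=.
  by apply: eq_bigl => i; rewrite in_setT.
move=> i _ ir; apply/eqP; by apply: contraNT ir => /fr.
Qed.

Lemma fin_supp2 f g : fin_supp f -> fin_supp g ->
  exists r : seq I, [/\ uniq r, forall x, f x != 0 -> x \in r
    & forall x, g x != 0 -> x \in r].
Proof.
move=> [r fr] [s gs]; exists (undup (r ++ s)); split; first exact: undup_uniq.
- by move=> x /fr xr; rewrite mem_undup mem_cat xr.
- by move=> x /gs xr; rewrite mem_undup mem_cat xr orbT.
Qed.

Lemma fin_supp_sub f g : (forall x, g x = 0 -> f x = 0) -> fin_supp g -> fin_supp f.
Proof.
move=> fg [r gr]; exists r => x fx; apply: gr.
by apply: contra fx => /eqP /fg ->.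
Qed.

Lemma fin_suppD f g : fin_supp f -> fin_supp g -> fin_supp (fun x => f x + g x).
Proof.
move=> /fin_supp2 /[apply] -[r [_ fr gr]]; exists r => x; apply: contraNT => xr.
have /eqP -> : f x == 0 by apply: contraNT xr => /fr.
have /eqP -> : g x == 0 by apply: contraNT xr => /gr.
by rewrite addr0.
Qed.

Lemma fin_suppMl c f : fin_supp f -> fin_supp (fun x => c x * f x).
Proof. by apply: fin_supp_sub => x ->; rewrite mulr0. Qed.

Lemma fin_suppMr c f : fin_supp f -> fin_supp (fun x => f x * c x).
Proof. by apply: fin_supp_sub => x ->; rewrite mul0r. Qed.

Lemma fin_supp_sqr f : fin_supp f -> fin_supp (fun x => f x ^+ 2).
Proof. by apply: fin_supp_sub => x ->; rewrite expr0n. Qed.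

Lemma fin_supp_sum (J : eqType) (s : seq J) (F : J -> I -> R) :
  (forall j, j \in s -> fin_supp (F j)) -> fin_supp (fun x => \sum_(j <- s) F j x).
Proof.
elim: s => [|j s IH] Fs.
  by exists [::] => x; rewrite big_nil eqxx.
apply: (@fin_supp_sub _ (fun x => F j x + \sum_(j <- s) F j x)).
  by move=> x; rewrite big_cons.
apply: fin_suppD; first by apply: Fs; rewrite mem_head.
by apply: IH => k ks; apply: Fs; rewrite inE ks orbT.
Qed.

Lemma fsumD f g : fin_supp f -> fin_supp g ->
  \sum_(x \in [set: I]) (f x + g x) =
  \sum_(x \in [set: I]) f x + \sum_(x \in [set: I]) g x.
Proof.
move=> ff fg; have [r [ur fr gr]] := fin_supp2 ff fg.
rewrite (fsum_seq ur fr) (fsum_seq ur gr) -big_split /=; apply: fsum_seq => // x.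
apply: contraNT => xr.
have /eqP -> : f x == 0 by apply: contraNT xr => /fr.
have /eqP -> : g x == 0 by apply: contraNT xr => /gr.
by rewrite addr0.
Qed.

Lemma fsum_exchange (J : eqType) (s : seq J) (F : J -> I -> R) :
  (forall j, j \in s -> fin_supp (F j)) ->
  \sum_(x \in [set: I]) \sum_(j <- s) F j x =
  \sum_(j <- s) \sum_(x \in [set: I]) F j x.
Proof.
elim: s => [|j s IH] Fs.
  by rewrite big_nil fsbig1// => x _; rewrite big_nil.
rewrite big_cons -IH; last by move=> k ks; apply: Fs; rewrite inE ks orbT.
rewrite -fsumD; first by apply: eq_fsbigr => x _; rewrite big_cons.
  by apply: Fs; rewrite mem_head.
by apply: fin_supp_sum => k ks; apply: Fs; rewrite inE ks orbT.
Qed.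

Lemma ler_fsum f g : fin_supp f -> fin_supp g -> (forall x, f x <= g x) ->
  \sum_(x \in [set: I]) f x <= \sum_(x \in [set: I]) g x.
Proof.
move=> ff fg fg'; have [r [ur fr gr]] := fin_supp2 ff fg.
by rewrite (fsum_seq ur fr) (fsum_seq ur gr); apply: ler_sum.
Qed.

Lemma ler_sum_fsum (r : seq I) f : uniq r -> fin_supp f -> (forall x, 0 <= f x) ->
  \sum_(x <- r) f x <= \sum_(x \in [set: I]) f x.
Proof.
move=> ur [s fs] f0.
rewrite (@fsum_seq (undup (r ++ s))) ?undup_uniq//; last first.
  by move=> x /fs xs; rewrite mem_undup mem_cat xs orbT.
have -> : \sum_(x <- r) f x = \sum_(x <- undup (r ++ s) | x \in r) f x.
  rewrite -[RHS]big_filter; apply/perm_big/uniq_perm => //.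
    by rewrite filter_uniq ?undup_uniq.
  by move=> x; rewrite mem_filter mem_undup mem_cat /=; case: (x \in r).
rewrite [leRHS](bigID (mem r) predT) /= lerDl.
exact: sumr_ge0.
Qed.

Lemma fsum_pointE (x0 : I) f : (forall x, x != x0 -> f x = 0) ->
  \sum_(x \in [set: I]) f x = f x0.
Proof.
move=> f0; rewrite (@fsum_seq [:: x0])//; first by rewrite big_seq1.
by move=> x; rewrite inE; apply: contraNT => /f0 ->.
Qed.

End FiniteSupport.

Section Shift.
Variables (R : realType) (I : zmodType).
Implicit Types f g : I -> R.

Lemma fsum_shift f (a : I) :
  \sum_(x \in [set: I]) f (x + a) = \sum_(x \in [set: I]) f x.
Proof.
rewrite -(@reindex_fsbigT _ _ _ _ _ (fun x => x + a) f)//.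
by exists (fun x => x - a) => x; [rewrite addrK | rewrite subrK].
Qed.

Lemma fin_supp_shift f (a : I) : fin_supp f -> fin_supp (fun x => f (x + a)).
Proof.
move=> [r fr]; exists [seq x - a | x <- r] => x /fr xr.
by apply/mapP; exists (x + a) => //; rewrite addrK.
Qed.

End Shift.

Section Box.
Variable d : nat.

(** The cube of radius N around c. The [undup] gives uniqueness at once, and for the size an upper
    bound suffices. *)
Definition box (N : nat) (c : 'rV[int]_d) : seq 'rV[int]_d :=
  undup [seq \row_i (c ord0 i + (nat_of_ord (j ord0 i))%:Z - N%:Z)
        | j : 'rV['I_(2 * N).+1]_d].

Lemma box_uniq N c : uniq (box N c). Proof. exact: undup_uniq. Qed.

Lemma size_box N c : (size (box N c) <= (2 * N).+1 ^ d)%N.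
Proof.
apply: (leq_trans (size_undup _)); rewrite size_map -cardE card_mx card_ord.
by rewrite mul1n.
Qed.

Lemma mem_box N (c x : 'rV[int]_d) : (forall i, `|x ord0 i - c ord0 i| <= N%:Z) -> x \in box N c.
Proof.
move=> xc; rewrite mem_undup; apply/mapP.
exists (\row_i inord (absz (x ord0 i - c ord0 i + N%:Z)%R)); first by rewrite mem_enum.
apply/rowP => i; rewrite !mxE inordK.
  have -> : x 0 i = x ord0 i by congr (x _ _); exact: val_inj.
  by have := xc i; move: (x _ _) (c _ _) => u v; lia.
by have := xc i; move: (x _ _) (c _ _) => u v; lia.
Qed.

End Box.

Section Walk.
Variables (R : realType) (d : nat) (p : 'rV[int]_d -> R).
Notation Zd := 'rV[int]_d.
Variable s : seq Zd.
Hypothesis s_uniq : uniq s.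
Hypothesis s_supp : forall x, p x != 0 -> x \in s.

(** Summing over the step z = y - x makes the index list independent of x, so that averages become
    finite sums over the fixed list [s]. *)
Lemma avgE h x : avg p h x = \sum_(z <- s) p z * h (x + z).
Proof.
rewrite /avg -(fsum_shift _ x) (@fsum_seq _ _ s)//.
  by apply: eq_bigr => z _; rewrite addrK addrC.
move=> z; apply: contraNT => /(contraNF (@s_supp z)) /negbT; rewrite negbK addrK.
by move=> /eqP ->; rewrite mul0r.
Qed.

Lemma pkS k x z : pk p k.+1 x z = \sum_(y <- s) p y * pk p k (x + y) z.
Proof. exact: (avgE (fun y => pk p k y z)). Qed.

Lemma pk_shift a k x z : pk p k (x + a) (z + a) = pk p k x z.
Proof.
elim: k x z => [|k IH] x z; first by rewrite /= (inj_eq (addIr a)).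
by rewrite !pkS; apply: eq_bigr => y _; rewrite addrAC IH.
Qed.

Lemma pkE k x z : pk p k x z = pk p k 0 (z - x).
Proof. by rewrite -(pk_shift (- x)) subrr. Qed.

(** By translation invariance the first step may be taken last. *)
Lemma pkSr k x z : pk p k.+1 x z = \sum_(y <- s) p y * pk p k x (z - y).
Proof.
by rewrite pkS; apply: eq_bigr => y _; rewrite -(pk_shift (- y)) addrK.
Qed.

Lemma pk_fin k x : fin_supp (pk p k x).
Proof.
elim: k x => [|k IH] x.
  exists [:: x] => z /=; rewrite inE; apply: contraNT.
  by rewrite eq_sym => /negbTE ->.
apply: (@fin_supp_sub _ _ _ (fun z => \sum_(y <- s) p y * pk p k (x + y) z)).
  by move=> z; rewrite pkS.
by apply: fin_supp_sum => y _; apply: fin_suppMl.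
Qed.

(** Identifies p^k with the k-th power of the averaging operator. The terms of the series are
    handled in this form, where measurability and recursions follow by induction on k. *)
Lemma fsum_pk k F x :
  \sum_(z \in [set: Zd]) F z * pk p k x z = iter k (avg p) F x.
Proof.
elim: k x => [|k IH] x.
  rewrite (@fsum_pointE _ _ x) /= ?eqxx ?mulr1// => z /negbTE.
  by rewrite eq_sym => ->; rewrite mulr0.
rewrite iterS avgE.
under eq_fsbigr do rewrite pkS mulr_sumr.
rewrite fsum_exchange; last first.
  by move=> y _; do 2 apply: fin_suppMl; exact: pk_fin.
apply: eq_bigr => y _; rewrite -IH mulr_fsumr.
by apply: eq_fsbigr => z _; rewrite mulrCA.
Qed.

Lemma iter_avg_shift k F x a :
  iter k (avg p) F (x + a) = iter k (avg p) (fun y => F (y + a)) x.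
Proof.
elim: k x => [|k IH] x//.
by rewrite !iterS !avgE; apply: eq_bigr => y _; rewrite addrAC IH.
Qed.

Lemma pk_ge0 : (forall x, 0 <= p x) -> forall k x z, 0 <= pk p k x z.
Proof.
move=> p0; elim=> [|k IH] x z; first exact: ler0n.
by rewrite pkS; apply: sumr_ge0 => y _; rewrite mulr_ge0.
Qed.

Hypothesis p_sum1 : \sum_(x <- s) p x = 1.

Lemma pk_sum1 k x : \sum_(z \in [set: Zd]) pk p k x z = 1.
Proof.
under eq_fsbigr do rewrite -[pk _ _ _ _]mul1r.
rewrite (fsum_pk _ (fun=> 1)); elim: k x => //= k IH x; rewrite avgE.
by under eq_bigr do rewrite IH mulr1.
Qed.

Definition collision k := \sum_(z \in [set: Zd]) pk p k 0 z ^+ 2.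

Lemma collisionE k x : \sum_(z \in [set: Zd]) pk p k x z ^+ 2 = collision k.
Proof.
rewrite /collision -(fsum_shift _ x).
by apply: eq_fsbigr => z _; rewrite pkE addrK.
Qed.

Lemma collision_ge0 k : 0 <= collision k.
Proof. by apply: fsumr_ge0 => i _; exact: sqr_ge0. Qed.

End Walk.

Ltac nz_lra := rewrite -?andbA; repeat (apply/andP; split); apply: lt0r_neq0; lra.

(** * Transience in dimension at least three *)

Section PolyaFlow.
Variable R : realFieldType.

Lemma ler_sum_telescope (f g : nat -> R) : (forall m, f m <= g m - g m.+1) ->
  (forall m, 0 <= g m) -> forall m N, \sum_(c < N) f (m + c)%N <= g m.
Proof.
move=> fg g0 m N; suff : \sum_(c < N) f (m + c)%N <= g m - g (m + N)%N.
  by move=> /le_trans; apply; rewrite gerBl.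
elim: N => [|N IH]; first by rewrite big_ord0 addn0 subrr.
rewrite big_ord_recr /= addnS; have := fg (m + N)%N; lra.
Qed.

Lemma sum_succ (G : nat -> R) N : G 0%N = 0 -> G N = 0 ->
  \sum_(a < N) G a.+1 = \sum_(a < N) G a.
Proof.
move=> G0 GN; have : \sum_(a < N.+1) G a = \sum_(a < N.+1) G a by [].
by rewrite {1}big_ord_recl big_ord_recr /= G0 GN add0r addr0.
Qed.

(** Level n has (n + 1)(n + 2) / 2 points, each visited with probability 2 / ((n + 1)(n + 2)); the
    remaining factor n + 3 is the denominator of the urn probabilities. *)
Let u (n : nat) : R := 2 / ((n%:R + 1) * (n%:R + 2) * (n%:R + 3)).

(* The flow of Polya's urn: it is the law of a random path which from the
   point [(a, b, c)] of level [n = a + b + c] increments the first coordinate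
   with probability [(a + 1) / (n + 3)], and which is uniformly distributed on
   each level. *)
Let th (a b c : nat) : R := (a%:R + 1) * u (a + b + c).

(** The same flow seen from its endpoint: at a point of level m, each axis brings in the
    corresponding coordinate times 2 / (m (m + 1)(m + 2)). *)
Let thS a b c : (a%:R + 1) * u (a + b + c) =
  a.+1%:R * (2 / ((a.+1 + b + c)%:R * ((a.+1 + b + c)%:R + 1) * ((a.+1 + b + c)%:R + 2))).
Proof.
rewrite /u !addSn -!natr1 !natrD.
have := ler0n R a; have := ler0n R b; have := ler0n R c.
by move: (a%:R) (b%:R) (c%:R) => x y z z0 y0 x0; field; nz_lra.
Qed.

Let sum3 N (F : nat -> nat -> nat -> R) :=
  \sum_(a < N) \sum_(b < N) \sum_(c < N) F a b c.

(** The three edges leaving a point of level n carry 2 / ((n + 1)(n + 2)) in total. The squares are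
    thus of order n^-4 over about n^2 / 2 points, which is summable over the levels. *)
Lemma polya_energy N :
  sum3 N (fun a b c => th a b c ^+ 2 + th b a c ^+ 2 + th c a b ^+ 2) <= 4.
Proof.
(* [g3], [g2] and [g1] are successive telescoping primitives of [g4], one for each coordinate
   summed, and the final bound is [g1 0 = 4]. The constant 24 makes [g4] equal to the squared
   outflow at level 0. *)
pose g4 (m : nat) : R := 24 / ((m%:R + 1) * (m%:R + 2) * (m%:R + 3) * (m%:R + 4)).
pose g3 (m : nat) : R := 8 / ((m%:R + 1) * (m%:R + 2) * (m%:R + 3)).
pose g2 (m : nat) : R := 4 / ((m%:R + 1) * (m%:R + 2)).
pose g1 (m : nat) : R := 4 / (m%:R + 1).
have g4E m : g4 m <= g3 m - g3 m.+1.
  rewrite /g4 /g3 -natr1 le_eqVlt; apply/orP; left; apply/eqP.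
  have := ler0n R m; set x := m%:R => x0.
  by field; nz_lra.
have g3E m : g3 m <= g2 m - g2 m.+1.
  rewrite /g3 /g2 -natr1 le_eqVlt; apply/orP; left; apply/eqP.
  have := ler0n R m; set x := m%:R => x0.
  by field; nz_lra.
have g2E m : g2 m <= g1 m - g1 m.+1.
  rewrite /g2 /g1 -natr1 le_eqVlt; apply/orP; left; apply/eqP.
  have := ler0n R m; set x := m%:R => x0.
  by field; nz_lra.
have gge0 m : [/\ 0 <= g3 m, 0 <= g2 m & 0 <= g1 m].
  by split; rewrite divr_ge0// ?mulr_ge0// addr_ge0.
apply: (@le_trans _ _ (sum3 N (fun a b c => g4 (a + b + c)%N))).
  apply: ler_sum => a _; apply: ler_sum => b _; apply: ler_sum => c _.
  rewrite /th (addnC b a) -(addnA c) (addnC c).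
  rewrite /g4 /u !natrD.
  have := ler0n R a; have := ler0n R b; have := ler0n R c.
  move: (a%:R) (b%:R) (c%:R) => x y z z0 y0 x0.
  set n := x + y + z.
  have n0 : 0 <= n by rewrite /n; lra.
  set v := 2 / _.
  (* The sum of the squares of the three outgoing flows is at most the square of their sum. *)
  apply: (@le_trans _ _ (((n + 3) * v) ^+ 2)).
    have v0 : 0 <= v ^+ 2 by exact: sqr_ge0.
    rewrite -subr_ge0 (_ : _ - _ =
      ((n + 3) ^+ 2 - ((x + 1) ^+ 2 + (y + 1) ^+ 2 + (z + 1) ^+ 2)) * v ^+ 2).
      apply: mulr_ge0 => //; rewrite /n; nra.
    ring.
  have -> : (n + 3) * v = 2 / ((n + 1) * (n + 2)).
    by rewrite /v; field; nz_lra.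
  have -> : 24 / ((n + 1) * (n + 2) * (n + 3) * (n + 4)) =
      (2 / ((n + 1) * (n + 2))) ^+ 2 + 4 * (5 * n ^+ 2 + 11 * n) /
      ((n + 1) ^+ 2 * (n + 2) ^+ 2 * (n + 3) * (n + 4)).
    by field; nz_lra.
  rewrite lerDl divr_ge0// ?mulr_ge0// ?exprn_ge0//; try lra.
  by rewrite addr_ge0// mulr_ge0// exprn_ge0.
apply: (@le_trans _ _ (\sum_(a < N) \sum_(b < N) g3 (a + b)%N)).
  do 2 (apply: ler_sum => ? _); apply: ler_sum_telescope => // m.
  by case: (gge0 m).
apply: (@le_trans _ _ (\sum_(a < N) g2 a)).
  apply: ler_sum => ? _; apply: ler_sum_telescope => // m.
  by case: (gge0 m).
have -> : 4 = g1 0%N by rewrite /g1; field.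
under eq_bigr => a _ do rewrite -[nat_of_ord a]add0n.
apply: ler_sum_telescope => // m.
by case: (gge0 m).
Qed.

Variables (N : nat) (phi : nat -> nat -> nat -> R).
Hypothesis phi0 : forall a b c, (N <= a)%N || (N <= b)%N || (N <= c)%N -> phi a b c = 0.

(** Summation by parts along each axis. The coefficient of [phi a b c] becomes inflow minus outflow,
    which is 0 away from the origin and -1 there. *)
Lemma polya_divergence :
  sum3 N (fun a b c => th a b c * (phi a.+1 b c - phi a b c)
    + th b a c * (phi a b.+1 c - phi a b c)
    + th c a b * (phi a b c.+1 - phi a b c)) = - phi 0%N 0%N 0%N.
Proof.
(* For n > 0 this is [u (n - 1)], so [a%:R * v (a + b + c)] is the flow entering along the first
   axis. It vanishes at a = 0 and [phi] vanishes at N, hence there is no boundary term. *)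
pose v (n : nat) : R := 2 / (n%:R * (n%:R + 1) * (n%:R + 2)).
have E1 b c : \sum_(a < N) th a b c * phi a.+1 b c =
    \sum_(a < N) a%:R * v (a + b + c)%N * phi a b c.
  rewrite -(@sum_succ (fun a => a%:R * v (a + b + c)%N * phi a b c)) ?mul0r//.
    by apply: eq_bigr => a _; rewrite /th thS.
  by rewrite phi0 ?leqnn// mulr0.
have E2 a c : \sum_(b < N) th b a c * phi a b.+1 c =
    \sum_(b < N) b%:R * v (a + b + c)%N * phi a b c.
  rewrite -(@sum_succ (fun b => b%:R * v (a + b + c)%N * phi a b c)) ?mul0r//.
    by apply: eq_bigr => b _; rewrite /th thS (addnC a).
  by rewrite phi0 ?leqnn ?orbT// mulr0.
have E3 a b : \sum_(c < N) th c a b * phi a b c.+1 =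
    \sum_(c < N) c%:R * v (a + b + c)%N * phi a b c.
  rewrite -(@sum_succ (fun c => c%:R * v (a + b + c)%N * phi a b c)) ?mul0r//.
    by apply: eq_bigr => c _; rewrite /th thS -(addnA c.+1) (addnC c.+1).
  by rewrite phi0 ?leqnn ?orbT// mulr0.
have S1 : sum3 N (fun a b c => th a b c * phi a.+1 b c) =
    sum3 N (fun a b c => a%:R * v (a + b + c)%N * phi a b c).
  rewrite /sum3 exchange_big [RHS]exchange_big; apply: eq_bigr => b _ /=.
  rewrite exchange_big [RHS]exchange_big; apply: eq_bigr => c _ /=.
  exact: E1.
have S2 : sum3 N (fun a b c => th b a c * phi a b.+1 c) =
    sum3 N (fun a b c => b%:R * v (a + b + c)%N * phi a b c).
  apply: eq_bigr => a _ /=.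
  rewrite exchange_big [RHS]exchange_big; apply: eq_bigr => c _ /=.
  exact: E2.
have S3 : sum3 N (fun a b c => th c a b * phi a b c.+1) =
    sum3 N (fun a b c => c%:R * v (a + b + c)%N * phi a b c).
  by apply: eq_bigr => a _; apply: eq_bigr => b _; exact: E3.
have lin (F G : nat -> nat -> nat -> R) :
    sum3 N F + sum3 N G = sum3 N (fun a b c => F a b c + G a b c).
  rewrite /sum3 -big_split; apply: eq_bigr => a _ /=.
  by rewrite -big_split; apply: eq_bigr => b _ /=; rewrite -big_split.
transitivity (sum3 N (fun a b c => th a b c * phi a.+1 b c)
  + sum3 N (fun a b c => th b a c * phi a b.+1 c)
  + sum3 N (fun a b c => th c a b * phi a b c.+1)
  + sum3 N (fun a b c => - (th a b c + th b a c + th c a b) * phi a b c)).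
  rewrite !lin; do 3 (apply: eq_bigr => ? _); ring.
rewrite S1 S2 S3 !lin.
(* At level n the inflow is n times [v n] and the outflow is n + 3 times [u n]. They agree for n >
   0, while at the origin the inflow is 0 and the outflow 1. *)
transitivity (sum3 N (fun a b c => - ((a == 0)%N && (b == 0)%N && (c == 0)%N)%:R * phi a b c)).
  apply: eq_bigr => a _; apply: eq_bigr => b _; apply: eq_bigr => c _.
  rewrite -!mulrDl; congr (_ * _).
  rewrite /th (addnC b a) -(addnA c) (addnC c).
  rewrite /u /v.
  have -> : (a == 0%N :> nat) && (b == 0%N :> nat) && (c == 0%N :> nat) = (a + b + c == 0)%N.
    by rewrite !addn_eq0.
  case: eqP => [|/eqP n0].
    move=> /eqP; rewrite !addn_eq0 => /andP[/andP[/eqP -> /eqP ->] /eqP ->].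
    by rewrite !addn0 -[nat_of_bool _]/1%N mulr1n !(add0r, mul0r); field.
  have : 0 < (a + b + c)%:R :> R by rewrite ltr0n lt0n.
  rewrite !natrD; move: (a%:R) (b%:R) (c%:R) => x y z h.
  by rewrite -[nat_of_bool _]/0%N mulr0n oppr0; field; nz_lra.
case: (posnP N) => [N0|N0].
  by rewrite /sum3 N0 big_ord0 phi0 ?N0// oppr0.
rewrite /sum3 (bigD1 (Ordinal N0))//= [X in _ + X]big1 ?addr0; last first.
  move=> a; rewrite -val_eqE /= => /negbTE ->.
  by do 2 (rewrite big1// => ? _); rewrite oppr0 mul0r.
rewrite (bigD1 (Ordinal N0))//= [X in _ + X]big1 ?addr0; last first.
  move=> b; rewrite -val_eqE /= => /negbTE ->.
  by rewrite big1// => ? _; rewrite oppr0 mul0r.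
rewrite (bigD1 (Ordinal N0))//= [X in _ + X]big1 ?addr0 ?mulN1r//.
by move=> c; rewrite -val_eqE /= => /negbTE ->; rewrite oppr0 mul0r.
Qed.

(* Completing the square against [phi 0 / 4] times the flow, which has
   divergence one at the origin and energy at most 4. *)
Lemma octant_hardy : phi 0%N 0%N 0%N ^+ 2 <=
  4 * sum3 N (fun a b c => (phi a.+1 b c - phi a b c) ^+ 2
    + (phi a b.+1 c - phi a b c) ^+ 2 + (phi a b c.+1 - phi a b c) ^+ 2).
Proof.
set x := phi 0%N 0%N 0%N; set E := sum3 _ _.
have lin (F G : nat -> nat -> nat -> R) k :
    sum3 N F + k * sum3 N G = sum3 N (fun a b c => F a b c + k * G a b c).
  rewrite /sum3 mulr_sumr -big_split; apply: eq_bigr => a _ /=.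
  rewrite mulr_sumr -big_split; apply: eq_bigr => b _ /=.
  by rewrite mulr_sumr -big_split.
have : 0 <= E + (2 * (x / 4)) * (- x) + (x / 4) ^+ 2 *
    sum3 N (fun a b c => th a b c ^+ 2 + th b a c ^+ 2 + th c a b ^+ 2).
  rewrite /x -polya_divergence -/x !lin.
  apply: sumr_ge0 => a _; apply: sumr_ge0 => b _; apply: sumr_ge0 => c _.
  set A := phi a.+1 b c - _; set B := phi a b.+1 c - _; set C := phi a b c.+1 - _.
  rewrite [X in 0 <= X](_ : _ = (A + x / 4 * th a b c) ^+ 2 + (B + x / 4 * th b a c) ^+ 2
     + (C + x / 4 * th c a b) ^+ 2); last by field.
  by rewrite !addr_ge0// sqr_ge0.
have := polya_energy N; set T := sum3 _ _.
have : 0 <= x ^+ 2 by exact: sqr_ge0.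
rewrite exprMn => h1 h2.
have : x ^+ 2 * T <= x ^+ 2 * 4 by apply: ler_wpM2l.
rewrite (_ : 2 * (x / 4) * - x = - (x ^+ 2 / 2)); last by field.
rewrite exprVn => h3 h4; lra.
Qed.

End PolyaFlow.

(** * Dirichlet energy and truncated Green functions of the difference walk *)

Section Transience.
Variables (R : realType) (d : nat) (p : 'rV[int]_d -> R).
Notation Zd := 'rV[int]_d.
Variable s : seq Zd.
Hypothesis s_uniq : uniq s.
Hypothesis s_supp : forall x, p x != 0 -> x \in s.
Hypothesis p_ge0 : forall x, 0 <= p x.
Hypothesis p_sum1 : \sum_(x <- s) p x = 1.
Implicit Types f : Zd -> R.

Definition sqdiff z f : R := \sum_(x \in [set: Zd]) (f (x + z) - f x) ^+ 2.

(** Twice the Dirichlet form of the difference walk, as [energyE] shows. *)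
Definition energy f : R :=
  \sum_(z <- s) \sum_(z' <- s) p z * p z' * sqdiff (z - z') f.

Definition corr_op f x : R :=
  \sum_(z <- s) \sum_(z' <- s) p z * p z' * f (x + (z - z')).

Lemma sqdiff_fin z f : fin_supp f -> fin_supp (fun x => (f (x + z) - f x) ^+ 2).
Proof.
move=> ff; apply: (@fin_supp_sub _ _ _ (fun x => f (x + z) + -1 * f x)).
  by move=> x; rewrite mulN1r => ->; rewrite expr0n.
by apply: fin_suppD; [apply: fin_supp_shift|apply: fin_suppMl].
Qed.

Lemma sqdiff_ge0 z f : 0 <= sqdiff z f.
Proof. by apply: fsumr_ge0 => x _; exact: sqr_ge0. Qed.

(** The increment from x to x + a - b passes through x - b. With u, v, w the values at x + a - b, x
    - b and x, the two sides differ by the square of u + w - 2v. *)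
Lemma sqdiffB a b f : fin_supp f ->
  sqdiff (a - b) f <= 2 * sqdiff a f + 2 * sqdiff b f.
Proof.
move=> ff; rewrite /sqdiff.
rewrite -(fsum_shift (fun x => (f (x + a) - f x) ^+ 2) (- b)).
rewrite -(fsum_shift (fun x => (f (x + b) - f x) ^+ 2) (- b)).
rewrite !mulr_fsumr -fsumD; last 2 first.
- by apply: fin_suppMl; apply: (@fin_supp_shift _ _ (fun x => (f (x + a) - f x) ^+ 2)); exact: sqdiff_fin.
- by apply: fin_suppMl; apply: (@fin_supp_shift _ _ (fun x => (f (x + b) - f x) ^+ 2)); exact: sqdiff_fin.
apply: ler_fsum; first exact: sqdiff_fin.
  apply: fin_suppD; apply: fin_suppMl.
    by apply: (@fin_supp_shift _ _ (fun x => (f (x + a) - f x) ^+ 2)); exact: sqdiff_fin.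
  by apply: (@fin_supp_shift _ _ (fun x => (f (x + b) - f x) ^+ 2)); exact: sqdiff_fin.
move=> x; rewrite subrK -addrA (addrC (- b)).
move: (f (x + (a - b))) (f (x - b)) (f x) => u v w.
rewrite -subr_ge0 (_ : _ - _ = (u + w - 2 * v) ^+ 2) ?sqr_ge0//; ring.
Qed.

Lemma sqdiffE z f : fin_supp f -> sqdiff z f =
  2 * (\sum_(x \in [set: Zd]) f x ^+ 2) -
  2 * (\sum_(x \in [set: Zd]) f x * f (x + z)).
Proof.
move=> ff.
have f2 : fin_supp (fun x => f x ^+ 2) by exact: fin_supp_sqr.
have fz : fin_supp (fun x => f x * f (x + z)).
  exact: (fin_suppMr (fun x => f (x + z))).
have fz2 : fin_supp (fun x => f (x + z) ^+ 2).
  exact: (@fin_supp_shift _ _ (fun x => f x ^+ 2)).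
rewrite -mulrN1 -mulrA (mulrC _ (-1)) [in X in _ + X]mulrA mulrN1.
rewrite (mulr_natl _ 2) mulr2n.
rewrite -{1}(fsum_shift (fun x => f x ^+ 2) z) mulr_fsumr -!fsumD//.
- by apply: eq_fsbigr => x _; ring.
- exact: fin_suppD.
- exact: fin_suppMl.
Qed.

Lemma corr_op_fin f : fin_supp f -> fin_supp (corr_op f).
Proof.
move=> ff; apply: fin_supp_sum => z _; apply: fin_supp_sum => z' _.
by apply: fin_suppMl; exact: fin_supp_shift.
Qed.

Lemma energyE f : fin_supp f -> energy f =
  2 * \sum_(x \in [set: Zd]) f x * (f x - corr_op f x).
Proof.
move=> ff.
have f2 : fin_supp (fun x => f x ^+ 2) by exact: fin_supp_sqr.
have -> : \sum_(x \in [set: Zd]) f x * (f x - corr_op f x) =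
   \sum_(x \in [set: Zd]) f x ^+ 2 - \sum_(x \in [set: Zd]) f x * corr_op f x.
  rewrite -mulN1r mulr_fsumr -fsumD//.
    by apply: eq_fsbigr => x _; ring.
  by apply: fin_suppMl; exact: fin_suppMr.
have -> : \sum_(x \in [set: Zd]) f x * corr_op f x =
  \sum_(z <- s) \sum_(z' <- s) p z * p z' *
    \sum_(x \in [set: Zd]) f x * f (x + (z - z')).
  rewrite /corr_op.
  under eq_fsbigr do rewrite mulr_sumr.
  rewrite fsum_exchange; last by move=> z _; exact: fin_suppMr.
  apply: eq_bigr => z _.
  under eq_fsbigr do rewrite mulr_sumr.
  rewrite fsum_exchange; last by move=> z' _; exact: fin_suppMr.
  apply: eq_bigr => z' _; rewrite mulr_fsumr.
  by apply: eq_fsbigr => x _; rewrite mulrCA.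
set F := \sum_(x \in [set: Zd]) f x ^+ 2.
have {1}-> : F = \sum_(z <- s) \sum_(z' <- s) p z * p z' * F.
  under eq_bigr do rewrite -mulr_suml -mulr_sumr p_sum1 mulr1.
  by rewrite -mulr_suml p_sum1 mul1r.
rewrite -sumrB mulr_sumr; apply: eq_bigr => z _.
rewrite -sumrB mulr_sumr; apply: eq_bigr => z' _.
by rewrite sqdiffE// -/F; ring.
Qed.

Lemma energy_ge0 f : 0 <= energy f.
Proof.
apply: sumr_ge0 => z _; apply: sumr_ge0 => z' _.
by rewrite !mulr_ge0// sqdiff_ge0.
Qed.

(* [walk_corr k] is the law of the difference of two independent [k]-step walks,
   and [corr_op] is the one-step operator of that symmetric walk. *)
Definition walk_corr k x : R :=
  \sum_(y \in [set: Zd]) pk p k 0 y * pk p k 0 (y - x).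

Lemma walk_corr0 x : walk_corr 0 x = (x == 0)%:R.
Proof.
rewrite /walk_corr (@fsum_pointE _ _ 0) /=; last first.
  by move=> y /negbTE; rewrite eq_sym => ->; rewrite mul0r.
by rewrite eqxx mul1r sub0r eq_sym oppr_eq0.
Qed.

Lemma walk_corr_eq0 k : walk_corr k 0 = collision p k.
Proof. by apply: eq_fsbigr => y _; rewrite subr0. Qed.

Lemma walk_corr_ge0 k x : 0 <= walk_corr k x.
Proof.
by apply: fsumr_ge0 => y _; rewrite mulr_ge0//; apply: pk_ge0 s_uniq s_supp _ _ _ _.
Qed.

(** Both walks are decomposed at their last step. Translating the summation variable by one of the
    two steps leaves only their difference. *)
Lemma walk_corrS k x : walk_corr k.+1 x = corr_op (walk_corr k) x.
Proof.
rewrite /walk_corr /corr_op.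
have wf := pk_fin s_uniq s_supp k 0.
have wsh z : fin_supp (fun y => pk p k 0 (y - z)) by exact: fin_supp_shift.
under eq_fsbigr => y _.
  rewrite (pkSr s_uniq s_supp k 0 y) mulr_suml.
  under eq_bigr do rewrite (pkSr s_uniq s_supp k 0 (y - x)) mulr_sumr.
  over.
rewrite fsum_exchange; last first.
  move=> z _; apply: fin_supp_sum => z' _; apply: fin_suppMr; exact: fin_suppMl.
rewrite exchange_big /=; apply: eq_bigr => z _.
rewrite fsum_exchange; last first.
  move=> z' _; apply: fin_suppMr; exact: fin_suppMl.
apply: eq_bigr => z' _.
rewrite -(fsum_shift _ z) mulr_fsumr.
apply: eq_fsbigr => y _; rewrite addrK.
rewrite mulrACA; congr (_ * (_ * pk p k 0 _)).
  by rewrite mulrC.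
by rewrite opprD opprB !addrA; congr (_ - _); rewrite addrAC.
Qed.

Lemma walk_corr_fin k : fin_supp (walk_corr k).
Proof.
elim: k => [|k IH].
  exists [:: 0] => x; rewrite walk_corr0 inE; apply: contraNT => /negbTE ->.
  by [].
apply: (@fin_supp_sub _ _ _ (corr_op (walk_corr k))).
  by move=> x <-; rewrite walk_corrS.
exact: corr_op_fin.
Qed.

Definition green n x := \sum_(k < n) walk_corr k x.

Lemma green_fin n : fin_supp (green n).
Proof. by apply: fin_supp_sum => k _; exact: walk_corr_fin. Qed.

Lemma green_ge0 n x : 0 <= green n x.
Proof. by apply: sumr_ge0 => k _; exact: walk_corr_ge0. Qed.

(** A telescoping sum of powers of [corr_op]; the term [walk_corr n] is the error of truncation. *)
Lemma green_resolvent n x :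
  green n x - corr_op (green n) x = walk_corr 0 x - walk_corr n x.
Proof.
have -> : corr_op (green n) x = \sum_(k < n) walk_corr k.+1 x.
  rewrite (eq_bigr (fun k : 'I_n => corr_op (walk_corr k) x)); last first.
    by move=> k _; rewrite walk_corrS.
  rewrite /corr_op [RHS]exchange_big; apply: eq_bigr => z _ /=.
  rewrite [RHS]exchange_big; apply: eq_bigr => z' _.
  by rewrite /green mulr_sumr.
elim: n => [|n IH]; first by rewrite /green !big_ord0 !subrr.
rewrite /green !big_ord_recr /= opprD addrACA IH; ring.
Qed.

(** The resolvent identity is paired with [green n], which is nonnegative. The mass at 0 produces
    [green n 0], the truncation error has the favourable sign, and the factor 2 is that of
    [energyE]. *)
Lemma energy_green n : energy (green n) <= 2 * green n 0.
Proof.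
rewrite energyE; last exact: green_fin.
rewrite ler_pM2l//.
have -> : green n 0 = \sum_(x \in [set: Zd]) green n x * walk_corr 0 x.
  rewrite (@fsum_pointE _ _ 0) ?walk_corr0 ?eqxx ?mulr1// => x /negbTE x0.
  by rewrite walk_corr0 x0 mulr0.
apply: ler_fsum; try by apply: fin_suppMr; exact: green_fin.
move=> x; rewrite green_resolvent; apply: ler_wpM2l; first exact: green_ge0.
by rewrite gerBl walk_corr_ge0.
Qed.

Hypothesis p_aper : strongly_aperiodic p.

(* The [z] admitting such a [C] form a subgroup, which contains [x - x0] as soon
   as [p x > 0] and [p x0 > 0]: aperiodicity is used with [u = - x0]. *)
Lemma sqdiff_le_energy z :
  exists C : R, 0 <= C /\ forall f, fin_supp f -> sqdiff z f <= C * energy f.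
Proof.
have [x0 x0s px0] : exists2 x0, x0 \in s & 0 < p x0.
  apply/not_exists2P => nx.
  have : \sum_(x <- s) p x = 0.
    rewrite big_seq big1// => x xs; apply/eqP; rewrite eq_le p_ge0 andbT leNgt.
    by apply/negP => px; have [] := nx x.
  by rewrite p_sum1 => /eqP; rewrite oner_eq0.
pose G := [set z | exists C : R, 0 <= C /\
  forall f, fin_supp f -> sqdiff z f <= C * energy f].
suff : G = setT by move=> GT; have : G z by rewrite GT.
apply: (p_aper (u := - x0)).
- exists 0; split=> // f ff; rewrite mul0r /sqdiff fsbig1// => x _.
  by rewrite addr0 subrr expr0n.
- move=> a b [A [A0 Af]] [B [B0 Bf]]; exists (2 * A + 2 * B); split.
    by rewrite addr_ge0// mulr_ge0.
  move=> f ff; apply: (le_trans (sqdiffB _ _ ff)).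
  have -> : (2 * A + 2 * B) * energy f = 2 * (A * energy f) + 2 * (B * energy f).
    by ring.
  by have := Af _ ff; have := Bf _ ff; lra.
(* The pair of steps x and x0 contributes to the energy the term [sqdiff (x - x0) f] with weight
   [p x * p x0]; the other terms are nonnegative. *)
- move=> x px; exists (p x * p x0)^-1; split.
    by rewrite invr_ge0 mulr_ge0// ltW.
  move=> f ff; rewrite ler_pdivlMl ?mulr_gt0// addrC.
  have xs : x \in s by apply: s_supp; rewrite gt_eqF.
  rewrite /energy (big_rem x xs) /= (big_rem x0 x0s) /= -addrA lerDl.
  apply: addr_ge0.
    by apply: sumr_ge0 => z' _; rewrite !mulr_ge0// sqdiff_ge0.
  apply: sumr_ge0 => z1 _; apply: sumr_ge0 => z' _.
  by rewrite !mulr_ge0// sqdiff_ge0.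
Qed.

(** Three distinct axes span a copy of the octant in the lattice, to which [octant_hardy]
    applies. *)
Lemma hardy f (i j k : 'I_d) : i != j -> i != k -> j != k -> fin_supp f ->
  f 0 ^+ 2 <= 4 * (sqdiff (delta_mx ord0 i) f + sqdiff (delta_mx ord0 j) f
                 + sqdiff (delta_mx ord0 k) f).
Proof.
move=> ij ik jk ff; have [r fr] := ff.
pose pt (a b c : nat) : Zd := delta_mx ord0 i *+ a + delta_mx ord0 j *+ b
   + delta_mx ord0 k *+ c.
have pti a b c : pt a b c ord0 i = a%:Z.
  rewrite /pt !mxE !mulmxnE !mxE !eqxx /= (negbTE ij) (negbTE ik) !mul0rn !addr0.
  exact: natz.
have ptj a b c : pt a b c ord0 j = b%:Z.
  rewrite /pt !mxE !mulmxnE !mxE !eqxx /= (eq_sym j i) (negbTE ij) (negbTE jk).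
  by rewrite !mul0rn !addr0 add0r; exact: natz.
have ptk a b c : pt a b c ord0 k = c%:Z.
  rewrite /pt !mxE !mulmxnE !mxE !eqxx /= !(eq_sym k) (negbTE ik) (negbTE jk).
  by rewrite !mul0rn !add0r; exact: natz.
(* Larger than every coordinate of every point of the support, so that [f] vanishes on the far faces
   of the cube. *)
pose N := (\sum_(x <- r) \sum_(l < d) absz (x ord0 l)).+1.
have rN x l : x \in r -> (absz (x ord0 l) < N)%N.
  move=> xr; rewrite ltnS (big_rem x xr) /= (bigD1 l)//= -addnA; exact: leq_addr.
have phi0 a b c : (N <= a)%N || (N <= b)%N || (N <= c)%N -> f (pt a b c) = 0.
  move=> H; apply/eqP; apply: contraLR H => /fr /rN H.
  rewrite !negb_or -!ltnNge; have := H i; have := H j; have := H k.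
  by rewrite pti ptj ptk !absz_nat => -> -> ->.
have := @octant_hardy _ N (fun a b c => f (pt a b c)) phi0.
have -> : pt 0%N 0%N 0%N = 0 by rewrite /pt !mulr0n !addr0.
move=> /le_trans; apply; rewrite ler_pM2l//.
have sumT (F : nat -> nat -> nat -> R) : \sum_(a < N) \sum_(b < N) \sum_(c < N) F a b c =
    \sum_(v : 'I_N * ('I_N * 'I_N)) F v.1 v.2.1 v.2.2.
  under eq_bigr do rewrite pair_big /=.
  by rewrite pair_big.
(* The embedding of the octant is injective, so its sum is part of the full sum of squares. *)
have dir z : \sum_(v : 'I_N * ('I_N * 'I_N))
    (f (pt v.1 v.2.1 v.2.2 + z) - f (pt v.1 v.2.1 v.2.2)) ^+ 2 <= sqdiff z f.
  rewrite -(big_map (fun v : 'I_N * ('I_N * 'I_N) => pt v.1 v.2.1 v.2.2) predT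
    (fun x => (f (x + z) - f x) ^+ 2)).
  apply: ler_sum_fsum; last by move=> x; exact: sqr_ge0.
    rewrite map_inj_uniq ?index_enum_uniq// => -[a [b c]] [a' [b' c']] /= E.
    have := congr1 (fun x : Zd => x ord0 i) E; rewrite !pti => -[] /val_inj ->.
    have := congr1 (fun x : Zd => x ord0 j) E; rewrite !ptj => -[] /val_inj ->.
    by have := congr1 (fun x : Zd => x ord0 k) E; rewrite !ptk => -[] /val_inj ->.
  exact: sqdiff_fin.
rewrite (sumT (fun a b c => (f (pt a.+1 b c) - f (pt a b c)) ^+ 2 +
  (f (pt a b.+1 c) - f (pt a b c)) ^+ 2 + (f (pt a b c.+1) - f (pt a b c)) ^+ 2)).
rewrite 2!big_split /=.
have pt1 a b c : pt a.+1 b c = pt a b c + delta_mx ord0 i.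
  by rewrite /pt mulrSr -!addrA; congr (_ + _); rewrite addrC -!addrA.
have pt2 a b c : pt a b.+1 c = pt a b c + delta_mx ord0 j.
  by rewrite /pt mulrSr -!addrA; congr (_ + (_ + _)); rewrite addrC.
have pt3 a b c : pt a b c.+1 = pt a b c + delta_mx ord0 k.
  by rewrite /pt mulrSr -!addrA.
under eq_bigr do rewrite pt1.
under [X in _ + X + _]eq_bigr do rewrite pt2.
under [X in _ + X]eq_bigr do rewrite pt3.
by rewrite !lerD.
Qed.

Lemma collision_bounded : (3 <= d)%N ->
  exists C, forall n, \sum_(k < n) collision p k <= C.
Proof.
move=> d3.
have d1 : (0 < d)%N by apply: leq_trans d3.
have d2 : (1 < d)%N by apply: leq_trans d3.
have [A [A0 Af]] := sqdiff_le_energy (delta_mx ord0 (Ordinal d1)).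
have [B [B0 Bf]] := sqdiff_le_energy (delta_mx ord0 (Ordinal d2)).
have [C [C0 Cf]] := sqdiff_le_energy (delta_mx ord0 (Ordinal d3)).
(* The 4 of [hardy] times the 2 of [energy_green]. *)
exists (8 * (A + B + C)) => n.
have -> : \sum_(k < n) collision p k = green n 0.
  by apply: eq_bigr => k _; rewrite walk_corr_eq0.
have gf := green_fin n.
have := @hardy (green n) (Ordinal d1) (Ordinal d2) (Ordinal d3) isT isT isT gf.
have := Af _ gf; have := Bf _ gf; have := Cf _ gf.
have := energy_green n; have := energy_ge0 (green n); have := green_ge0 n 0.
set g := green n 0; set e := energy _.
move=> g0 e0 eg hc hb ha.
have hA : A * e <= A * (2 * g) by apply: ler_wpM2l.
have hB : B * e <= B * (2 * g) by apply: ler_wpM2l.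
have hC : C * e <= C * (2 * g) by apply: ler_wpM2l.
move=> hg; have {}hg : g ^+ 2 <= 8 * (A + B + C) * g by nra.
have [->|gn0] := eqVneq g 0; first by rewrite mulr_ge0// !addr_ge0.
by rewrite -(@ler_pM2r _ g) ?lt_def ?gn0// -expr2.
Qed.

End Transience.

(** * Recurrence in dimensions one and two *)

Section Recurrence.
Variables (R : realType) (d : nat) (p : 'rV[int]_d -> R).
Notation Zd := 'rV[int]_d.
Variable s : seq Zd.
Hypothesis s_uniq : uniq s.
Hypothesis s_supp : forall x, p x != 0 -> x \in s.
Hypothesis p_ge0 : forall x, 0 <= p x.
Hypothesis p_sum1 : \sum_(x <- s) p x = 1.

Let co (i : 'I_d) (z : Zd) : R := (z ord0 i)%:~R.

Definition drift i : R := \sum_(z <- s) p z * co i z.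
Definition spread i : R := \sum_(z <- s) p z * (co i z - drift i) ^+ 2.

Lemma spread_ge0 i : 0 <= spread i.
Proof. by apply: sumr_ge0 => z _; rewrite mulr_ge0// sqr_ge0. Qed.

(** Squared bias plus accumulated variance. The deviation of a step from [drift i] has mean zero, so
    the cross term drops and each step adds [spread i]. *)
Lemma second_moment k i (c : R) x :
  iter k (avg p) (fun z => (co i z - c) ^+ 2) x =
  (co i x + k%:R * drift i - c) ^+ 2 + k%:R * spread i.
Proof.
elim: k x => [|k IH] x; first by rewrite /= !mul0r !addr0.
rewrite iterS (avgE s_uniq s_supp).
set e := co i x + k.+1%:R * drift i - c.
rewrite (eq_bigr (fun z => p z * (e ^+ 2 + k%:R * spread i)
   + 2 * e * (p z * co i z - p z * drift i) + p z * (co i z - drift i) ^+ 2)).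
  rewrite !big_split /= -mulr_suml -mulr_sumr p_sum1 -/(spread i).
  by rewrite sumrB -/(drift i) -mulr_suml p_sum1 !mul1r subrr mulr0 addr0 -natr1; ring.
move=> z _; rewrite IH /e.
have -> : co i (x + z) = co i x + co i z by rewrite /co mxE intrD.
by rewrite -natr1; ring.
Qed.

(** Off the box, the sum over the coordinates of the squared deviations from the mean is at least
    N^2, so divided by N^2 it dominates the indicator of the complement. The centre is rounded down
    to a lattice point. *)
Lemma chebyshev_box k N : (0 < N)%N ->
  1 - \sum_(y <- box N (\row_i Num.floor (k%:R * drift i))) pk p k 0 y <=
  k%:R * (\sum_i spread i) / N%:R ^+ 2.
Proof.
move=> N0; set r := box _ _.
have N20 : 0 < N%:R ^+ 2 :> R by rewrite exprn_gt0// ltr0n.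
have wf := pk_fin s_uniq s_supp k 0.
have w0 := pk_ge0 s_uniq s_supp p_ge0 k 0.
have -> : \sum_(y <- r) pk p k 0 y =
    \sum_(y \in [set: Zd]) (y \in r)%:R * pk p k 0 y.
  rewrite (@fsum_seq _ _ r) ?box_uniq//; last first.
    by move=> y; apply: contraNT => /negbTE ->; rewrite mul0r.
  by rewrite !big_seq; apply: eq_bigr => y ->; rewrite mul1r.
rewrite -[X in X - _](pk_sum1 s_uniq s_supp p_sum1 k 0) -mulN1r mulr_fsumr -fsumD//; last first.
  by do 2 apply: fin_suppMl.
have -> : k%:R * (\sum_i spread i) / N%:R ^+ 2 =
    \sum_(y \in [set: Zd]) (\sum_i (co i y - k%:R * drift i) ^+ 2) / N%:R ^+ 2
      * pk p k 0 y.
  rewrite (fsum_pk s_uniq s_supp).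
  have -> : k%:R * (\sum_i spread i) = \sum_i iter k (avg p) (fun z => (co i z - k%:R * drift i) ^+ 2) 0.
    rewrite mulr_sumr; apply: eq_bigr => i _; rewrite second_moment.
    by rewrite /co mxE mulr0z add0r subrr expr0n add0r.
  rewrite -(fsum_pk s_uniq s_supp).
  under eq_fsbigr do rewrite mulrAC.
  rewrite -mulr_fsuml; congr (_ / _).
  under eq_bigr do rewrite -(fsum_pk s_uniq s_supp).
  rewrite -fsum_exchange; last by move=> i _; apply: fin_suppMl.
  by apply: eq_fsbigr => y _; rewrite mulr_suml.
apply: ler_fsum.
- by apply: fin_suppD => //; do 2 apply: fin_suppMl.
- exact: fin_suppMl.
move=> y; case: (boolP (y \in r)) => [yr|yr].
  rewrite mul1r mulN1r subrr; apply: mulr_ge0 => //.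
  by apply: divr_ge0; [apply: sumr_ge0 => i _; exact: sqr_ge0 | exact: ltW].
rewrite mul0r mulr0 addr0 ler_peMl// ler_pdivlMr// mul1r.
have [i Hi] : exists i, ~~ (`|y ord0 i - Num.floor (k%:R * drift i)| <= N%:Z).
  apply/existsP; rewrite -negb_forall; apply: contra yr => /forallP H.
  by apply: mem_box => i; rewrite mxE.
rewrite (bigD1 i)//= -[leLHS]addr0 lerD//; last first.
  by apply: sumr_ge0 => j _; exact: sqr_ge0.
rewrite -[leRHS]real_normK ?num_real//; apply: lerXn2r; rewrite ?nnegrE//.
set m := k%:R * drift i in Hi *.
have := @real_floor_itv R m (num_real _).
set f := Num.floor m in Hi * => /andP[f1 f2].
rewrite /co; move: (y ord0 i) Hi => u Hi.
(* An integer at distance more than N from the floor is at distance at least N + 1, and rounding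
   loses at most 1 of it. *)
have [H|H] : (f + 1 + N%:Z <= u) \/ (u + N%:Z + 1 <= f).
  by move: Hi; rewrite -ltNge; lia.
- have : (f + 1 + N%:Z)%:~R <= u%:~R :> R by rewrite ler_int.
  move: f2; rewrite !intrD -pmulrn => f2 h; rewrite ler_normr; apply/orP; left; lra.
- have : (u + N%:Z + 1)%:~R <= f%:~R :> R by rewrite ler_int.
  rewrite !intrD -pmulrn => h; rewrite ler_normr; apply/orP; right.
  have : 0 <= N%:R :> R by [].
  lra.
Qed.

(* Half of the mass sits in a box, so by Cauchy-Schwarz the sum of squares is at
   least a constant over the size of the box. *)
Lemma collision_lower k N : (0 < N)%N ->
  k%:R * (\sum_i spread i) <= N%:R ^+ 2 / 2 ->
  (4 * ((2 * N).+1 ^ d)%:R)^-1 <= collision p k.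
Proof.
move=> N0 kN.
have N20 : 0 < N%:R ^+ 2 :> R by rewrite exprn_gt0// ltr0n.
have := chebyshev_box k N0.
set r := box _ _; set T := \sum_(y <- r) _ => hT.
have {hT}T12 : 2^-1 <= T.
  have : k%:R * (\sum_i spread i) / N%:R ^+ 2 <= 2^-1.
    by rewrite ler_pdivrMr// [leRHS]mulrC.
  lra.
set B : R := ((2 * N).+1 ^ d)%:R.
have B0 : 0 < B by rewrite ltr0n expn_gt0.
have rB : (size r)%:R <= B by rewrite ler_nat size_box.
have qr : \sum_(y <- r) pk p k 0 y ^+ 2 <= collision p k.
  apply: ler_sum_fsum; first exact: box_uniq.
    by apply: fin_supp_sqr; exact: pk_fin s_uniq s_supp _ _.
  by move=> y; exact: sqr_ge0.
apply: le_trans qr.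
(* The maximiser of 2 t T - B t^2 at T = 1/2. Expanding the sum of the squares of p^k - t gives the
   lower bound t - B t^2 = t / 2. *)
set t := (2 * B)^-1.
have t0 : 0 < t by rewrite invr_gt0 mulr_gt0.
have : 0 <= \sum_(y <- r) (pk p k 0 y - t) ^+ 2.
  by apply: sumr_ge0 => y _; exact: sqr_ge0.
have -> : \sum_(y <- r) (pk p k 0 y - t) ^+ 2 =
   \sum_(y <- r) pk p k 0 y ^+ 2 - 2 * t * T + (size r)%:R * t ^+ 2.
  rewrite /T; elim: (r) => [|y r' IH]; first by rewrite !big_nil /=; ring.
  by rewrite !big_cons IH /= -natr1; ring.
have h1 : (size r)%:R * t ^+ 2 <= B * t ^+ 2 by apply: ler_wpM2r => //; rewrite exprn_ge0// ltW.
have h2 : 2 * t * 2^-1 <= 2 * t * T by apply: ler_wpM2l => //; rewrite mulr_ge0// ltW.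
have h3 : B * t ^+ 2 = t / 2.
  by rewrite /t; field; rewrite gt_eqF.
have -> : (4 * B)^-1 = t / 2 by rewrite /t; field; rewrite gt_eqF.
move: h1 h2; rewrite h3 (_ : 2 * t * 2^-1 = t); last by field.
lra.
Qed.

Lemma collision_unbounded : (d <= 2)%N ->
  forall C, exists n, C <= \sum_(k < n) collision p k.
Proof.
move=> d2 C.
set V := \sum_i spread i.
have V0 : 0 <= V by apply: sumr_ge0 => i _; exact: spread_ge0.
(* Chosen so that radius K 2^j meets the condition of [collision_lower] for every k up to 4^j. *)
pose K := (Num.truncn (2 * V)).+1.
have K2 : 2 * V <= K%:R ^+ 2.
  apply: (@le_trans _ _ K%:R).
    by apply/ltW/truncnS_gt.
  by rewrite -natrX ler_nat -mulnn leq_pmulr.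
have q0 := collision_ge0 p.
(* The contribution of one block: between 4^J and 4^(J + 1) there are 3 * 4^J indices, each
   contributing at least 1 / (36 K^2 4^(J + 1)). *)
pose c : R := (48 * K%:R ^+ 2)^-1.
have K0 : 0 < K%:R ^+ 2 :> R by rewrite exprn_gt0// ltr0n.
have c0 : 0 < c by rewrite invr_gt0 mulr_gt0.
(* Since d <= 2, a box of radius N = K 2^j has at most (2 N + 1)^2 <= 9 N^2 points, and 36 = 4 *
   9. *)
have low j k : (k <= 4 ^ j)%N -> (36 * K%:R ^+ 2 * 4 ^+ j)^-1 <= collision p k.
  move=> kj; pose N := (K * 2 ^ j)%N.
  have N0 : (0 < N)%N by rewrite muln_gt0 expn_gt0.
  have NE : N%:R ^+ 2 = K%:R ^+ 2 * 4 ^+ j :> R.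
    by rewrite /N natrM exprMn natrX exprAC; congr (_ * _ ^+ j); ring.
  apply: (@le_trans _ _ (4 * ((2 * N).+1 ^ d)%:R)^-1); last first.
    apply: collision_lower => //; rewrite -/V NE.
    have : k%:R <= 4 ^+ j :> R by rewrite -natrX ler_nat.
    have j0 : 0 <= 4 ^+ j :> R by rewrite exprn_ge0.
    move=> h; apply: (@le_trans _ _ (4 ^+ j * V)); first exact: ler_wpM2r.
    have := ler_wpM2l j0 K2; lra.
  have -> : 36 * K%:R ^+ 2 * 4 ^+ j = 4 * (9 * N%:R ^+ 2) :> R by rewrite NE; ring.
  rewrite lef_pV2 ?posrE ?mulr_gt0 ?exprn_gt0 ?ltr0n ?expn_gt0//.
  rewrite ler_pM2l// -natrX -natrM ler_nat.
  apply: (@leq_trans ((2 * N).+1 ^ 2)); first by rewrite leq_exp2l//; lia.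
  by rewrite -!mulnn; nia.
have key J : J%:R * c <= \sum_(k < 4 ^ J) collision p k.
  elim: J => [|J IH]; first by rewrite mul0r sumr_ge0.
  have -> : (4 ^ J.+1 = 4 ^ J + 3 * 4 ^ J)%N by rewrite expnS; lia.
  rewrite big_split_ord /= -natr1 mulrDl mul1r lerD//.
  apply: (@le_trans _ _ (\sum_(i < 3 * 4 ^ J) (36 * K%:R ^+ 2 * 4 ^+ J.+1)^-1)).
    rewrite sumr_const card_ord -[leRHS]mulr_natl natrM natrX (exprS 4) /c.
    rewrite le_eqVlt; apply/orP; left; apply/eqP; field.
    by rewrite expf_neq0 ?pnatr_eq0// gt_eqF.
  apply: ler_sum => i _; apply: low; have := ltn_ord i; rewrite expnS /=; lia.
exists (4 ^ (Num.truncn (C / c)).+1)%N; apply: le_trans (key _).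
by rewrite -ler_pdivrMr//; apply/ltW/truncnS_gt.
Qed.

End Recurrence.

(** * Independence *)

Section Independence.
Context (dO : measure_display) (Omega : measurableType dO) (R : realType)
  (P : probability Omega R).

(** For fixed B, the finite measures A -> P(A and B) and A -> P(A) P(B) agree on a pi-system, hence
    on the sigma-algebra it generates. *)
Lemma indep_sigma (F : set (set Omega)) (B : set Omega) :
  F `<=` measurable -> setI_closed F -> F setT -> measurable B ->
  (forall A, F A -> P (A `&` B) = (P A * P B)%E) ->
  forall A, <<s F >> A -> P (A `&` B) = (P A * P B)%E.
Proof.
move=> Fm FI FT mB FB A FA.
have Pfin : P B \is a fin_num by exact: fin_num_measure.
pose k := NngNum (fine_ge0 (measure_ge0 P B)).
have E A' : mscale k P A' = (P A' * P B)%E by rewrite /mscale /= fineK// muleC.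
have : mrestr P mB A = mscale k P A.
  apply: (g_sigma_algebra_measure_unique F Fm (fun=> setT)) => //.
  - by rewrite bigcup_const//; exists 0%N.
  - by move=> A' FA'; rewrite [RHS]E -FB.
  - move=> _; change (P (setT `&` B) < +oo)%E.
    by rewrite ltey_eq fin_num_measure//; exact: measurableI.
by rewrite E.
Qed.

Lemma indep2_sigma (F G : set (set Omega)) :
  F `<=` measurable -> setI_closed F -> F setT ->
  G `<=` measurable -> setI_closed G -> G setT ->
  (forall A B, F A -> G B -> P (A `&` B) = (P A * P B)%E) ->
  indep2 P <<s F >> <<s G >>.
Proof.
move=> Fm FI FT Gm GI GT FG A B FA GB.
have mA : measurable A.
  exact: (smallest_sub (@sigma_algebra_measurable _ Omega) Fm).
rewrite setIC muleC; apply: (indep_sigma Gm) GB => // B' GB'.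
rewrite setIC muleC; apply: (indep_sigma Fm) FA => //; first exact: Gm.
by move=> A' FA'; apply: FG.
Qed.

End Independence.

Section Cylinders.
Context (T : Type) (R : realType) (I : choiceType) (X : I -> T -> R).

Definition cyl (S : set I) : set (set T) :=
  [set A | exists (J : {fset I}) (B : I -> set R),
     [/\ forall j, j \in J -> S j, forall j, measurable (B j) &
         A = \bigcap_(j in [set` J]) X j @^-1` B j]].

Lemma cylI S : setI_closed (cyl S).
Proof.
move=> _ _ [J1 [B1 [S1 m1 ->]]] [J2 [B2 [S2 m2 ->]]].
exists (J1 `|` J2)%fset, (fun j => (if j \in J1 then B1 j else setT) `&`
  (if j \in J2 then B2 j else setT)); split.
- by move=> j; rewrite inE => /orP[/S1|/S2].
- by move=> j; apply: measurableI; case: ifP.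
apply/seteqP; split => [w [h1 h2] j /=|w h].
  by move=> _; split; case: ifP => // jJ; first [exact: h1|exact: h2].
split=> j jJ.
  have : j \in (J1 `|` J2)%fset by rewrite inE jJ.
  by move=> /h [+ _]; rewrite ifT.
have : j \in (J1 `|` J2)%fset by rewrite inE jJ orbT.
by move=> /h [_]; rewrite ifT.
Qed.

Lemma cylT S : cyl S setT.
Proof.
exists fset0, (fun=> setT); split=> //; last by apply/seteqP; split.
Qed.

Lemma gen_sigmaP S i B : S i -> measurable B -> gen_sigma X S (X i @^-1` B).
Proof.
move=> Si mB; apply: sub_sigma_algebra; exists i => //=.
by exists B.
Qed.

Lemma gen_sigma_sub S (C : set (set T)) : sigma_algebra setT C ->
  (forall i B, S i -> measurable B -> C (X i @^-1` B)) -> gen_sigma X S `<=` C.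
Proof.
by move=> Csig h; apply: smallest_sub => // _ [i Si [B mB <-]]; exact: h.
Qed.

Lemma cyl1 S i B : S i -> measurable B -> cyl S (X i @^-1` B).
Proof.
move=> Si mB; exists [fset i]%fset, (fun=> B); split => //.
  by move=> j; rewrite inE => /eqP ->.
apply/seteqP; split => [w h j /=|w h].
  by rewrite inE => /eqP ->.
by apply: h; rewrite /= inE.
Qed.

Lemma gen_sigma_cyl S : gen_sigma X S `<=` <<s cyl S >>.
Proof.
apply: gen_sigma_sub; first exact: smallest_sigma_algebra.
by move=> i B Si mB; apply: sub_sigma_algebra; exact: cyl1.
Qed.

Lemma gen_sigma_sigma S : sigma_algebra setT (gen_sigma X S).
Proof. exact: smallest_sigma_algebra. Qed.

Lemma gen_sigma_preimage A :
  prod_sigma A -> gen_sigma X setT ((fun w i => X i w) @^-1` A).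
Proof.
pose C := [set A | gen_sigma X setT ((fun w i => X i w) @^-1` A)].
have [g0 gC gU] := gen_sigma_sigma setT.
suff : @prod_sigma I R `<=` C by apply.
apply: smallest_sub.
  split => [|B CB|F CF]; rewrite /C /=.
  - by rewrite preimage_set0.
  - by have := gC _ CB; rewrite !setTD preimage_setC.
  - by rewrite preimage_bigcup; apply: gU.
by move=> _ [i _ [B mB <-]]; rewrite /C /= -comp_preimage; exact: gen_sigmaP.
Qed.

End Cylinders.

Section IndependentFamily.
Context (dO : measure_display) (Omega : measurableType dO) (R : realType)
  (P : probability Omega R) (I : choiceType) (X : I -> Omega -> R).
Hypothesis mX : forall i, measurable_fun setT (X i).
Hypothesis iX : indep_family P (fun i => gen_sigma X [set i]).

Lemma measurable_preimage i B : measurable B -> measurable (X i @^-1` B).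
Proof. by move=> mB; rewrite -[X in measurable X]setTI; exact: mX. Qed.

Lemma gen_sigma_measurable S : gen_sigma X S `<=` measurable.
Proof.
apply: gen_sigma_sub; first exact: sigma_algebra_measurable.
by move=> i B _; exact: measurable_preimage.
Qed.

Lemma cyl_measurable S : cyl X S `<=` measurable.
Proof.
move=> _ [J [B [JS mB ->]]]; apply: fin_bigcap_measurable => //.
by move=> j _; exact: measurable_preimage.
Qed.

Lemma prob_cyl (J : {fset I}) (B : I -> set R) : (forall j, measurable (B j)) ->
  P (\bigcap_(j in [set` J]) X j @^-1` B j) = (\prod_(j <- J) P (X j @^-1` B j))%E.
Proof. by move=> mB; apply: iX => j _; exact: gen_sigmaP. Qed.

Lemma indep_cyl S T A B : S `&` T = set0 -> cyl X S A -> cyl X T B ->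
  P (A `&` B) = (P A * P B)%E.
Proof.
move=> ST [J1 [B1 [S1 m1 ->]]] [J2 [B2 [S2 m2 ->]]].
have J12 j : j \in J1 -> j \in J2 -> False.
  by move=> /S1 s1 /S2 s2; have : (S `&` T) j by []; rewrite ST.
rewrite !prob_cyl//.
pose B3 j := if j \in J1 then B1 j else B2 j.
have -> : \bigcap_(j in [set` J1]) X j @^-1` B1 j `&`
   \bigcap_(j in [set` J2]) X j @^-1` B2 j =
   \bigcap_(j in [set` (J1 `|` J2)%fset]) X j @^-1` B3 j.
  rewrite /B3; apply/seteqP; split => [w [h1 h2] j /=|w h].
    by rewrite inE => /orP[] jJ; case: ifPn => [/h1//|/negP jn]; last exact: h2.
  split=> j /= jJ; have := h j; rewrite /= inE jJ ?orbT => /(_ isT) //.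
  by case: ifPn => // /J12 /(_ jJ).
rewrite prob_cyl; last by move=> j; rewrite /B3; case: ifP.
rewrite (perm_big (J1 ++ J2)) /=; last first.
  apply: uniq_perm; first exact: fset_uniq.
    rewrite cat_uniq !fset_uniq andbT /=; apply/hasPn => j /= j2.
    by apply/negP => j1; exact: J12 j1 j2.
  by move=> j; rewrite inE mem_cat.
rewrite big_cat /=; congr (_ * _)%E; rewrite !big_seq; apply: eq_bigr => j jJ; rewrite /B3.
  by rewrite jJ.
by case: ifPn => // /J12 /(_ jJ).
Qed.

Lemma indep_disjoint S T : S `&` T = set0 ->
  indep2 P (gen_sigma X S) (gen_sigma X T).
Proof.
move=> ST A B /gen_sigma_cyl gA /gen_sigma_cyl gB.
apply: indep2_sigma gA gB; try exact: cyl_measurable; try exact: cylI;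
  try exact: cylT.
by move=> A' B'; exact: indep_cyl.
Qed.

End IndependentFamily.

(** * Expectation of a product of independent variables *)

Section ExpectationProduct.
Context (dO : measure_display) (Omega : measurableType dO) (R : realType)
  (P : probability Omega R).

Definition indep_rv (X Y : Omega -> R) := forall A B, measurable A -> measurable B ->
  P (X @^-1` A `&` Y @^-1` B) = (P (X @^-1` A) * P (Y @^-1` B))%E.

Variables X Y : Omega -> R.
Hypothesis mX : measurable_fun setT X.
Hypothesis mY : measurable_fun setT Y.
Hypothesis XY : indep_rv X Y.
Hypothesis iX : P.-integrable setT (EFin \o X).
Hypothesis iY : P.-integrable setT (EFin \o Y).

Let X' : {mfun Omega >-> R} := HB.pack X (isMeasurableFun.Build _ _ _ _ X mX).
Let Y' : {mfun Omega >-> R} := HB.pack Y (isMeasurableFun.Build _ _ _ _ Y mY).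

Let mZ : measurable_fun setT (fun w => (X w, Y w)).
Proof. exact: measurable_fun_pair. Qed.

Let Z' : {mfun Omega >-> (R * R)%type} :=
  HB.pack (fun w => (X w, Y w)) (isMeasurableFun.Build _ _ _ _ _ mZ).

Let joint E : measurable E ->
  (distribution P X' \x distribution P Y')%E E = distribution P Z' E.
Proof.
apply: product_measure_unique => A B mA mB.
by rewrite -[RHS]XY.
Qed.

Lemma ge0_integral_joint (f : R * R -> \bar R) : measurable_fun setT f ->
  (forall z, 0 <= f z)%E ->
  (\int[P]_w f (X w, Y w) =
   \int[distribution P X']_x \int[distribution P Y']_y f (x, y))%E.
Proof.
move=> mf f0.
rewrite -(ge0_integral_distribution Z' mf f0).
rewrite (eq_measure_integral (distribution P X' \x distribution P Y')%E); last first.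
  by move=> E mE _; exact/esym/joint.
exact: fubini_tonelli1.
Qed.

Let mM : measurable_fun setT (fun z : R * R => (z.1 * z.2)%:E).
Proof.
apply: measurableT_comp => //.
by apply: measurable_funM; [exact: measurable_fst|exact: measurable_snd].
Qed.

Let EX' : (\int[distribution P X']_x x%:E = \int[P]_w (X w)%:E)%E.
Proof. by rewrite integral_distribution. Qed.

Let EY' : (\int[distribution P Y']_x x%:E = \int[P]_w (Y w)%:E)%E.
Proof. by rewrite integral_distribution. Qed.

Let iX' : (distribution P X').-integrable setT (EFin : R -> \bar R).
Proof.
have /integrableP[_ h] := iX; apply/integrableP; split => //.
rewrite ge0_integral_distribution//.
exact: measurableT_comp.
Qed.

Let iY' : (distribution P Y').-integrable setT (EFin : R -> \bar R).
Proof.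
have /integrableP[_ h] := iY; apply/integrableP; split => //.
rewrite ge0_integral_distribution//.
exact: measurableT_comp.
Qed.

(** By Tonelli under the joint law, the mean of |X Y| is the product of the means of |X| and |Y|, so
    first moments suffice. *)
Lemma integrable_indepM : P.-integrable setT (EFin \o (fun w => X w * Y w)).
Proof.
apply/integrableP; split.
  by apply: measurableT_comp => //; exact: measurable_funM.
rewrite (@ge0_integral_joint (fun z => `|(z.1 * z.2)%:E|%E))//; last first.
  exact: measurableT_comp.
have /integrableP[_ hX] := iX'.
have /integrableP[_ hY] := iY'.
have hYf : (\int[distribution P Y']_y `|y%:E|)%E \is a fin_num.
  by rewrite ge0_fin_numE// integral_ge0.
under eq_integral => x _.
  rewrite (eq_integral (fun y : R => `|x|%:E * `|y%:E|)%E); last first.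
    by move=> y _; rewrite /= normrM EFinM.
  rewrite ge0_integralZl//; last exact: measurableT_comp.
  rewrite -(fineK hYf).
  over.
rewrite ge0_integralZr//; last first.
- by rewrite lee_fin fine_ge0// integral_ge0.
- exact: measurableT_comp.
by apply: lte_mul_pinfty => //; [exact: integral_ge0|rewrite ge0_fin_numE//; exact: integral_ge0|exact: ltry].
Qed.

Lemma integral_indepM : (\int[P]_w (X w * Y w)%:E =
  \int[P]_w (X w)%:E * \int[P]_w (Y w)%:E)%E.
Proof.
have iM := integrable_indepM.
rewrite -EX' -EY'.
rewrite -(@integral_distribution _ _ _ _ _ P Z' (fun z => (z.1 * z.2)%:E))//.
rewrite (eq_measure_integral (distribution P X' \x distribution P Y')%E); last first.
  by move=> E mE _; exact/esym/joint.
rewrite -integral12_prod_meas1; last first.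
  apply/integrableP; split => //.
  rewrite (eq_measure_integral (distribution P Z')); last first.
    by move=> E mE _; exact: joint.
  rewrite ge0_integral_distribution//; last exact: measurableT_comp.
  by have /integrableP[_] := iM.
have hYf : (\int[distribution P Y']_y y%:E)%E \is a fin_num.
  exact: integrable_fin_num.
rewrite /fubini_F /=.
under eq_integral => x _.
  rewrite (eq_integral (fun y : R => x%:E * y%:E)%E); last by move=> y _; rewrite EFinM.
  rewrite integralZl// -(fineK hYf).
  over.
by rewrite integralZr// fineK.
Qed.

End ExpectationProduct.

(** * Kolmogorov's maximal inequality and convergence of random series *)

Section SquareIntegrable.
Context (dO : measure_display) (Omega : measurableType dO) (R : realType)
  (P : probability Omega R).
Implicit Types X Y : Omega -> R.

Definition sqint X :=
  measurable_fun setT X /\ P.-integrable setT (EFin \o (fun w => X w ^+ 2)).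

Lemma le_integrable_EFin X Y : measurable_fun setT X ->
  P.-integrable setT (EFin \o Y) -> (forall w, `|X w| <= Y w) ->
  P.-integrable setT (EFin \o X).
Proof.
move=> mX iY XY; apply: (le_integrable _ _ _ iY) => //.
  exact/measurable_EFinP.
move=> w _ /=; rewrite lee_fin; apply: (le_trans (XY w)); exact: ler_norm.
Qed.

Lemma integrable_EFinD X Y : P.-integrable setT (EFin \o X) ->
  P.-integrable setT (EFin \o Y) -> P.-integrable setT (EFin \o (fun w => X w + Y w)).
Proof.
move=> iX iY; rewrite (_ : _ \o _ = (EFin \o X) \+ (EFin \o Y))%E//.
exact: integrableD.
Qed.

Lemma integrable_EFinZ c X : P.-integrable setT (EFin \o X) ->
  P.-integrable setT (EFin \o (fun w => c * X w)).
Proof.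
move=> iX; rewrite (_ : _ \o _ = (fun w => c%:E * (EFin \o X) w)%E)//.
exact: integrableZl.
Qed.

Lemma sqint_mul X Y : sqint X -> sqint Y ->
  P.-integrable setT (EFin \o (fun w => X w * Y w)).
Proof.
move=> [mX iX] [mY iY].
apply: (@le_integrable_EFin _ (fun w => X w ^+ 2 + Y w ^+ 2)).
- exact: measurable_funM.
- exact: integrable_EFinD.
- move=> w; rewrite normrM -(real_normK (num_real (X w))) -(real_normK (num_real (Y w))).
  have := sqr_ge0 (`|X w| - `|Y w|); have := normr_ge0 (X w); have := normr_ge0 (Y w).
  nra.
Qed.

Lemma sqint_cst c : sqint (fun=> c).
Proof.
by split=> //; exact: finite_measure_integrable_cst.
Qed.

Lemma sqint_integrable X : sqint X -> P.-integrable setT (EFin \o X).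
Proof.
move=> sX; have := sqint_mul sX (sqint_cst 1).
by under [fun w => _ * _]eq_fun do rewrite mulr1.
Qed.

Lemma sqintD X Y : sqint X -> sqint Y -> sqint (fun w => X w + Y w).
Proof.
move=> sX sY; split; first by apply: measurable_funD; [case: sX|case: sY].
have -> : (fun w => (X w + Y w) ^+ 2) =
    (fun w => (X w ^+ 2 + 2 * (X w * Y w)) + Y w ^+ 2).
  by apply/funext => w; ring.
apply: integrable_EFinD; last by case: sY.
apply: integrable_EFinD; first by case: sX.
by apply: integrable_EFinZ; exact: sqint_mul.
Qed.

Lemma sqintZ c X : sqint X -> sqint (fun w => c * X w).
Proof.
move=> [mX iX]; split; first exact: measurable_funM.
under [fun w => _ ^+ 2]eq_fun do rewrite exprMn.
exact: integrable_EFinZ.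
Qed.

Lemma sqint_sum (J : Type) (r : seq J) (F : J -> Omega -> R) :
  (forall j, sqint (F j)) -> sqint (fun w => \sum_(j <- r) F j w).
Proof.
move=> sF; elim: r => [|j r IH].
  by under [fun w => _]eq_fun do rewrite big_nil; exact: sqint_cst.
by under [fun w => _]eq_fun do rewrite big_cons; exact: sqintD.
Qed.

Lemma sqint_mulb (H : Omega -> R) X : measurable_fun setT H -> (forall w, `|H w| <= 1) -> sqint X ->
  sqint (fun w => H w * X w).
Proof.
move=> mH H1 [mX iX]; split; first exact: measurable_funM.
apply: (@le_integrable_EFin _ (fun w => X w ^+ 2)) => //.
  by apply: measurable_funX; exact: measurable_funM.
move=> w; rewrite normrX normrM exprMn -[leRHS]mul1r -(real_normK (num_real (X w))).
by apply: ler_wpM2r; rewrite ?exprn_ge0// -[leRHS](expr1n _ 2) lerXn2r// nnegrE.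
Qed.

End SquareIntegrable.

(** * Transforms of independent increments by bounded predictable weights *)

Section PredictableTransform.
Context (dO : measure_display) (Omega : measurableType dO) (R : realType)
  (P : probability Omega R).
Variable C : nat -> set (set Omega).
Hypothesis C_meas : forall k, C k `<=` measurable.
Hypothesis C_incr : forall k, <<s C k >> `<=` <<s C k.+1 >>.

Lemma sigma_sub_measurable (D : set (set Omega)) : D `<=` measurable ->
  <<s D >> `<=` measurable.
Proof. by move=> Dm; apply: smallest_sub; first exact: sigma_algebra_measurable. Qed.

Lemma filt_measurable (D : set (set Omega)) (X : Omega -> R) : D `<=` measurable ->
  measurable_fun [set: g_sigma_algebraType D] X -> measurable_fun [set: Omega] X.
Proof.
move=> Dm mX _ B mB.
exact: (sigma_sub_measurable Dm) (mX _ _ mB).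
Qed.

Lemma filt_sub (D D' : set (set Omega)) (X : Omega -> R) : <<s D >> `<=` <<s D' >> ->
  measurable_fun [set: g_sigma_algebraType D] X ->
  measurable_fun [set: g_sigma_algebraType D'] X.
Proof. by move=> DD mX _ B mB; exact: DD (mX _ _ mB). Qed.

Lemma filt_preimage (D : set (set Omega)) (X : Omega -> R) B :
  measurable_fun [set: g_sigma_algebraType D] X -> measurable B ->
  <<s D >> (X @^-1` B).
Proof. by move=> mX mB; have := mX measurableT B mB; rewrite setTI. Qed.

Variable Y : nat -> Omega -> R.
Hypothesis Y_meas : forall k, measurable_fun [set: g_sigma_algebraType (C k.+1)] (Y k).
Hypothesis Y_sq : forall k, sqint P (Y k).
Hypothesis Y_mean : forall k, \int[P]_w Y k w = 0.
Hypothesis Y_indep : forall k A B, <<s C k >> A -> measurable B ->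
  P (A `&` Y k @^-1` B) = (P A * P (Y k @^-1` B))%E.

Lemma filt_le m n : (m <= n)%N -> <<s C m >> `<=` <<s C n >>.
Proof.
elim: n => [|n IH]; first by rewrite leqn0 => /eqP ->.
rewrite leq_eqVlt => /orP[/eqP -> //|]; rewrite ltnS => /IH h.
by move=> A /h; exact: C_incr.
Qed.

Section Transform.
Variable H : nat -> Omega -> R.
Hypothesis H_meas : forall k, measurable_fun [set: g_sigma_algebraType (C k)] (H k).
Hypothesis H_le1 : forall k w, `|H k w| <= 1.

(** A martingale transform: the weight [H k] is measurable for the past [C k], which is independent
    of [Y k]. *)
Definition transform n w := \sum_(k < n) H k w * Y k w.

Lemma transform_meas n : measurable_fun [set: g_sigma_algebraType (C n)] (transform n).
Proof.
rewrite /transform; elim: n => [|n IH].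
  under [fun w => _]eq_fun do rewrite big_ord0; exact: measurable_cst.
under [fun w => _]eq_fun do rewrite big_ord_recr /=.
apply: measurable_funD; first exact: (filt_sub (@C_incr n) IH).
by apply: measurable_funM => //; exact: (filt_sub (@C_incr n) (@H_meas n)).
Qed.

Lemma transform_sqint n : sqint P (transform n).
Proof.
rewrite /transform; elim: n => [|n IH].
  by under [fun w => _]eq_fun do rewrite big_ord0; exact: sqint_cst.
under [fun w => _]eq_fun do rewrite big_ord_recr /=.
apply: sqintD => //; apply: sqint_mulb => //.
exact: (filt_measurable (@C_meas n) (@H_meas n)).
Qed.

(** The product of [H n] and [transform n] belongs to the past [C n], so its product with the
    centred [Y n] has mean zero. The diagonal terms are controlled by |H| <= 1. *)
Lemma transform_L2 n :
  \int[P]_w (transform n w ^+ 2) <= \sum_(k < n) \int[P]_w (Y k w ^+ 2).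
Proof.
elim: n => [|n IH].
  rewrite big_ord0 /transform; under eq_Rintegral do rewrite big_ord0 expr0n /=.
  by rewrite Rintegral_cst// mul0r.
rewrite big_ord_recr /=.
have mH : measurable_fun setT (H n) by exact: (filt_measurable (@C_meas n) (@H_meas n)).
have sHY : sqint P (fun w => H n w * Y n w) by exact: sqint_mulb.
have sT := transform_sqint n.
have sHT : sqint P (fun w => H n w * transform n w) by exact: sqint_mulb.
have mHT : measurable_fun [set: g_sigma_algebraType (C n)] (fun w => H n w * transform n w).
  by apply: measurable_funM => //; exact: transform_meas.
have iHT : P.-integrable setT (EFin \o (fun w => H n w * transform n w)).
  exact: sqint_integrable.
have iY : P.-integrable setT (EFin \o Y n) by exact: sqint_integrable.
have indep : indep_rv P (fun w => H n w * transform n w) (Y n).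
  by move=> A B mA mB; apply: Y_indep => //; exact: filt_preimage.
have iHTY := integrable_indepM (proj1 sHT) (proj1 (Y_sq n)) indep iHT iY.
have cross : \int[P]_w ((H n w * transform n w) * Y n w) = 0.
  rewrite /Rintegral (integral_indepM (proj1 sHT) (proj1 (Y_sq n)) indep iHT iY).
  rewrite fineM; try exact: integrable_fin_num.
  by rewrite [X in _ * X](Y_mean n) mulr0.
have -> : \int[P]_w (transform n.+1 w ^+ 2) =
   \int[P]_w (transform n w ^+ 2) + \int[P]_w ((H n w * Y n w) ^+ 2).
  rewrite -[X in _ = X + _]addr0 -(mulr0 2) -[in X in _ + X + _]cross -RintegralZl//.
  rewrite -RintegralD//; [|by case: sT|exact: integrable_EFinZ].
  rewrite -RintegralD//; [|apply: integrable_EFinD; [by case: sT|exact: integrable_EFinZ]|by case: sHY].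
  apply: eq_Rintegral => w _; rewrite /transform big_ord_recr /=; ring.
apply: lerD => //; apply: le_Rintegral => //; [by case: sHY|by case: (Y_sq n)|].
move=> w _; rewrite exprMn -[leRHS]mul1r; apply: ler_wpM2r; first exact: sqr_ge0.
rewrite -(real_normK (num_real (H n w))) -[leRHS](expr1n _ 2) lerXn2r// nnegrE//.
Qed.

End Transform.

Let S n w : R := \sum_(k < n) Y k w.

Lemma partial_sum_transform n : S n = transform (fun _ _ => 1) n.
Proof.
by apply/funext => w; apply: eq_bigr => k _; rewrite mul1r.
Qed.

Lemma partial_sum_meas n : measurable_fun [set: g_sigma_algebraType (C n)] (S n).
Proof. by rewrite partial_sum_transform; apply: transform_meas => k; exact: measurable_cst. Qed.

Lemma partial_sum_L2 n :
  \int[P]_w (S n w ^+ 2) <= \sum_(k < n) \int[P]_w (Y k w ^+ 2).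
Proof.
by rewrite partial_sum_transform; apply: transform_L2 => // k w; rewrite normr1.
Qed.

Definition exceeds (e : R) n : set Omega := [set w | exists2 j, (j <= n)%N & e <= `|S j w|].

Lemma exceeds_measurable e n : <<s C n >> (exceeds e n).
Proof.
have -> : exceeds e n = \bigcup_(j in `I_n.+1) (S j @^-1` [set x | e <= `|x|]).
  apply/seteqP; split => [w [j jn ej]|w [j /= jn ej]].
    by exists j.
  by exists j.
rewrite -[<<s _ >>]/(@measurable _ (g_sigma_algebraType (C n))).
apply: fin_bigcup_measurable => // j /=; rewrite ltnS => jn.
have mj : measurable_fun [set: g_sigma_algebraType (C n)] (S j).
  exact: (filt_sub (@filt_le j n jn) (@partial_sum_meas j)).
rewrite -[X in measurable X]setTI.
rewrite (_ : S j @^-1` _ = (fun w => `|S j w|) @^-1` `[e, +oo[%classic); last first.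
  by apply/seteqP; split => w /=; rewrite in_itv /= andbT.
by apply: measurableT_comp => //.
Qed.

(* The sum stopped when it first leaves ]-e, e[ is a transform of the increments. *)
Lemma kolmogorov_maximal (e : R) n : 0 < e ->
  (P (exceeds e n) <= ((\sum_(k < n) \int[P]_w (Y k w ^+ 2)) / e ^+ 2)%:E)%E.
Proof.
move=> e0; pose H k : Omega -> R := \1_(~` exceeds e k).
have H_meas k : measurable_fun [set: g_sigma_algebraType (C k)] (H k).
  apply: (@measurable_indic _ (g_sigma_algebraType (C k))).
  by apply: measurableC; exact: exceeds_measurable.
have H1 k w : `|H k w| <= 1.
  by rewrite /H indicE; case: (_ \in _); rewrite ?normr1 ?normr0.
have stopped j w : ~ (exists2 i, (i < j)%N & e <= `|S i w|) -> transform H j w = S j w.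
  move=> nj; apply: eq_bigr => k _; rewrite /H indicE mem_set ?mul1r//=.
  move=> [i ik ei]; apply: nj; exists i => //; exact: leq_ltn_trans ik _.
have sub : exceeds e n `<=` [set w | (e ^+ 2)%:E <= `|(transform H n w ^+ 2)%:E|]%E.
  move=> w [j0 j0n ej0].
  have ex : exists j, (e <= `|S j w|) && (j <= n)%N by exists j0; rewrite ej0.
  case: (ex_minnP ex) => j /andP[ej jn] jmin.
  (* At the first exit time j the weights are 1 for k < j and 0 for k >= j. *)
  have E : transform H n w = S j w.
    rewrite -stopped; last first.
      move=> [i ij ei]; have := jmin i; rewrite ei (leq_trans (ltnW ij) jn).
      by move=> /(_ isT); rewrite leqNgt ij.
    rewrite /transform -(subnKC jn) big_split_ord /= [X in _ + X]big1 ?addr0// => k _.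
    rewrite /H indicE memNset ?mul0r//= => h.
    by apply: h; exists j => //; exact: leq_addr.
  rewrite /= E lee_fin ger0_norm ?sqr_ge0// -(real_normK (num_real (S j w))).
  by rewrite lerXn2r// nnegrE ltW.
have sT := transform_sqint H_meas H1 n.
have mT2 : measurable_fun setT (EFin \o (fun w => transform H n w ^+ 2)).
  by apply/measurable_EFinP/measurable_funX; case: sT.
have e20 : 0 < e ^+ 2 by rewrite exprn_gt0.
have := le_integral_abse P measurableT mT2 e20.
have iT2 : P.-integrable setT (EFin \o (fun w => transform H n w ^+ 2)) by case: sT.
have -> : (\int[P]_w `|(EFin \o (fun w => transform H n w ^+ 2)%R) w| =
    (\int[P]_w (transform H n w ^+ 2))%R%:E)%E.
  rewrite /Rintegral fineK; last exact: integrable_fin_num.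
  by apply: eq_integral => w _; rewrite /= ger0_norm// sqr_ge0.
rewrite setTI => h.
have mE : measurable (exceeds e n).
  exact: (@sigma_sub_measurable (C n) (@C_meas n) _ (@exceeds_measurable e n)).
have h2 : (P (exceeds e n) <= P [set w | ((e ^+ 2)%:E <= `|(transform H n w ^+ 2)%:E|)%E])%E.
  apply: le_measure; rewrite ?inE//.
  rewrite -[X in measurable X]setTI; apply: emeasurable_fun_c_infty => //.
  exact: measurableT_comp.
apply: (le_trans h2).
rewrite EFinM lee_pdivlMr// muleC; apply: (le_trans h).
by rewrite lee_fin; exact: transform_L2.
Qed.

End PredictableTransform.

(** * Almost sure and mean square convergence of series with summable variances *)

Section SeriesConvergence.
Context (dO : measure_display) (Omega : measurableType dO) (R : realType)
  (P : probability Omega R).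
Variable C : nat -> set (set Omega).
Hypothesis C_meas : forall k, C k `<=` measurable.
Hypothesis C_incr : forall k, <<s C k >> `<=` <<s C k.+1 >>.
Variable Y : nat -> Omega -> R.
Hypothesis Y_meas : forall k, measurable_fun [set: g_sigma_algebraType (C k.+1)] (Y k).
Hypothesis Y_sq : forall k, sqint P (Y k).
Hypothesis Y_mean : forall k, \int[P]_w Y k w = 0.
Hypothesis Y_indep : forall k A B, <<s C k >> A -> measurable B ->
  P (A `&` Y k @^-1` B) = (P A * P (Y k @^-1` B))%E.
Variable r : nat -> R.
Hypothesis r_tail : forall m n, \sum_(k < n) \int[P]_w (Y (m + k)%N w ^+ 2) <= r m.
Hypothesis r_cvg0 : r @ \oo --> 0.

Let S n w : R := \sum_(k < n) Y k w.

Let SD m j w : S (m + j) w - S m w = \sum_(k < j) Y (m + k)%N w.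
Proof. by rewrite /S big_split_ord /= addrAC subrr add0r. Qed.

Let C_incrD m k : <<s C (m + k)%N >> `<=` <<s C (m + k.+1)%N >>.
Proof. by rewrite addnS; exact: C_incr. Qed.

Let Y_measD m k : measurable_fun [set: g_sigma_algebraType (C (m + k.+1)%N)] (Y (m + k)%N).
Proof. by rewrite addnS; exact: Y_meas. Qed.

Let maximalD m e n : 0 < e ->
  (P (exceeds (fun k => Y (m + k)%N) e n) <= (r m / e ^+ 2)%:E)%E.
Proof.
move=> e0.
have := @kolmogorov_maximal _ _ _ P (fun k => C (m + k)%N) (fun k => @C_meas (m + k)%N)
   (@C_incrD m) (fun k => Y (m + k)%N) (@Y_measD m) (fun k => Y_sq (m + k)%N)
  (fun k => Y_mean (m + k)%N) (fun k => @Y_indep (m + k)%N) e n e0.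
move=> /le_trans; apply; rewrite lee_fin ler_pM2r ?invr_gt0 ?exprn_gt0//.
Qed.

Let measD m e n : measurable (exceeds (fun k => Y (m + k)%N) e n).
Proof.
exact: (@sigma_sub_measurable _ Omega (C (m + n)%N) (@C_meas (m + n)%N) _
  (@exceeds_measurable _ _ _ (fun k => C (m + k)%N)
  (@C_incrD m) (fun k => Y (m + k)%N) (@Y_measD m) e n)).
Qed.

(** Some partial sum started at index m leaves ]-e, e[. A point which, for every e = 1 / (i + 1),
    avoids this set for some m has Cauchy partial sums. *)
Let oscillates e m := \bigcup_n (exceeds (fun k => Y (m + k)%N) e n).

Let prob_oscillates e m : 0 < e -> (P (oscillates e m) <= (r m / e ^+ 2)%:E)%E.
Proof.
move=> e0.
have mU : measurable (oscillates e m) by apply: bigcup_measurable => n _; exact: measD.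
have nd : nondecreasing_seq (fun n => exceeds (fun k => Y (m + k)%N) e n).
  move=> n n' nn'; apply/subsetPset => w [j jn ej]; exists j => //.
  exact: leq_trans jn nn'.
have := nondecreasing_cvg_mu (mu := P) (measD m e) mU nd.
move=> /(@cvg_lim _ _); rewrite -/(oscillates e m) => <- //.
apply: lime_le.
  by apply: ereal_nondecreasing_is_cvgn => n n' nn'; apply: le_measure;
    rewrite ?inE//; apply/subsetPset; exact: nd.
by apply: nearW => n; exact: maximalD.
Qed.

Let oscillates_null e : 0 < e -> P.-negligible (\bigcap_m oscillates e m).
Proof.
move=> e0.
have mU m : measurable (oscillates e m) by apply: bigcup_measurable => n _; exact: measD.
have mI : measurable (\bigcap_m oscillates e m) by exact: bigcap_measurable.
exists (\bigcap_m oscillates e m); split => //.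
apply/eqP; rewrite eq_le measure_ge0 andbT leNgt; apply/negP => Ppos.
have Pfin : P (\bigcap_m oscillates e m) \is a fin_num by exact: fin_num_measure.
have d0 : 0 < fine (P (\bigcap_m oscillates e m)) * e ^+ 2.
  by rewrite mulr_gt0 ?exprn_gt0// fine_gt0// Ppos /= ltey_eq Pfin.
have [m _ /(_ m (leqnn m)) /= rm] := cvgr_lt (0 : R) r_cvg0 _ d0.
have : (P (\bigcap_m oscillates e m) <= (r m / e ^+ 2)%:E)%E.
  apply: le_trans (prob_oscillates m e0).
  by apply: le_measure; rewrite ?inE//; exact: bigcap_inf.
rewrite -(fineK Pfin) lee_fin ler_pdivlMr ?exprn_gt0//.
by rewrite leNgt rm.
Qed.

Lemma series_ae_cvg : {ae P, forall w, cvgn (fun n => \sum_(k < n) Y k w)}.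
Proof.
change (P.-negligible (~` [set w | cvgn (fun n => \sum_(k < n) Y k w)])).
have N : P.-negligible (\bigcup_i \bigcap_m oscillates (i.+1%:R^-1) m).
  by apply: negligible_bigcup => i; apply: oscillates_null; rewrite invr_gt0.
apply: (negligibleS _ N).
move=> w; apply: contra_notP => nw.
apply/cauchy_cvgP; apply: cauchy_exP => e e0.
have [i ie] : exists i : nat, i.+1%:R^-1 < e.
  exists (Num.truncn e^-1); rewrite invf_plt ?posrE//.
  exact: truncnS_gt.
have [m nm] : exists m, ~ oscillates (i.+1%:R^-1) m w.
  apply: contrapT => h; apply: nw; exists i => // m _.
  by apply: contrapT => h'; apply: h; exists m.
exists (S m w); exists m => // n /= mn.
rewrite /ball /= distrC -[n in X in `|X - _|](subnKC mn) SD.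
rewrite ltNge; apply/negP => h; apply: nm; exists (n - m)%N => //.
exists (n - m)%N => //; exact: le_trans (ltW ie) h.
Qed.

(** [S n - Z] is almost surely the limit in m of [S n - S (n + m)], whose second moments are at most
    [r n] for all m; Fatou's lemma passes to the limit. *)
Lemma series_L2 (Z : Omega -> R) n : measurable_fun setT Z ->
  {ae P, forall w, (fun n => \sum_(k < n) Y k w) @ \oo --> Z w} ->
  (\int[P]_w ((S n w - Z w) ^+ 2)%:E <= (r n)%:E)%E.
Proof.
move=> mZ SZ.
have sS m : sqint P (S m) by exact: sqint_sum.
pose f m w := ((S n w - S (n + m) w) ^+ 2)%:E.
have mf m : measurable_fun setT (f m).
  apply/measurable_EFinP/measurable_funX; by apply: measurable_funB; [case: (sS n)|case: (sS (n + m)%N)].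
have f0 m w : (0 <= f m w)%E by rewrite lee_fin sqr_ge0.
have -> : (\int[P]_w ((S n w - Z w) ^+ 2)%:E = \int[P]_w limn_einf (f^~ w))%E.
  apply: ae_eq_integral => //.
  - by apply/measurable_EFinP/measurable_funX; apply: measurable_funB => //; case: (sS n).
  - rewrite (_ : (fun _ => _) = (fun w => - limn_esup (-%E \o (f^~ w)))%E); last first.
      by apply/funext => w; rewrite limn_esupN oppeK.
    apply: measurableT_comp => //; apply: measurable_fun_limn_esup => m.
    exact: measurableT_comp.
  - apply: filterS SZ => w Sw _.
    have : f^~ w @ \oo --> ((S n w - Z w) ^+ 2)%:E.
      apply: cvg_EFin; first exact: nearW.
      have h : (fun m => S n w - S (n + m) w) @ \oo --> S n w - Z w.
        apply: cvgB; first exact: cvg_cst.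
        rewrite (_ : (fun m => S (n + m) w) = (fun m => S (m + n) w)); last first.
          by apply/funext => m; rewrite addnC.
        by rewrite (cvg_shiftn n (fun m => S m w)); exact: Sw.
      rewrite expr2 (_ : fine \o _ = (fun m => S n w - S (n + m) w) \*
        (fun m => S n w - S (n + m) w)); last by apply/funext => m; rewrite /= expr2.
      exact: cvgM.
    by move=> /cvg_limn_einf_sup [-> _].
apply: (le_trans (fatou P measurableT mf (fun m w _ => f0 m w))).
rewrite limn_einf_lim; apply: lime_le; first exact: is_cvg_einfs.
apply: nearW => m; apply: (@le_trans _ _ (\int[P]_w f m w)%E).
  by apply: ereal_inf_lbound; exists m => /=.
have sD : sqint P (fun w => \sum_(k < m) Y (n + k)%N w) by apply: sqint_sum.
have -> : (\int[P]_w f m w)%E = (\int[P]_w ((\sum_(k < m) Y (n + k)%N w) ^+ 2))%R%:E.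
  rewrite /Rintegral fineK; last by apply: integrable_fin_num => //; case: sD.
  by apply: eq_integral => w _; rewrite /f -SD; congr EFin; ring.
rewrite lee_fin; apply: le_trans (r_tail n m).
exact: (@partial_sum_L2 _ _ _ P (fun k => C (n + k)%N) (fun k => @C_meas (n + k)%N)
  (@C_incrD n) (fun k => Y (n + k)%N) (@Y_measD n) (fun k => Y_sq (n + k)%N)
  (fun k => Y_mean (n + k)%N) (fun k => @Y_indep (n + k)%N)).
Qed.

End SeriesConvergence.

(** * Mixing of the shift of an independent family *)

Section ShiftErgodicity.
Context (dO : measure_display) (Omega : measurableType dO) (R : realType)
  (P : probability Omega R) (I : zmodType) (X : I -> Omega -> R).
Hypothesis mX : forall i, measurable_fun setT (X i).
Hypothesis iX : indep_family P (fun i => gen_sigma X [set i]).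
Hypothesis lX : forall i j (B : set R), measurable B -> P (X i @^-1` B) = P (X j @^-1` B).

(** The whole path seen from v, as a point of the product space; [shifted 0] is the path itself. *)
Definition shifted (v : I) : Omega -> I -> R := fun w i => X (i + v) w.

Let co (i : I) (f : I -> R) := f i.

Lemma path_gen v A : prod_sigma A -> gen_sigma X setT (shifted v @^-1` A).
Proof.
move=> /(@gen_sigma_preimage _ _ _ (fun i => X (i + v))).
apply: gen_sigma_sub; first exact: gen_sigma_sigma.
by move=> i B _ mB; exact: gen_sigmaP.
Qed.

Lemma path_measurable v A : prod_sigma A -> measurable (shifted v @^-1` A).
Proof. by move=> /(path_gen v); exact: gen_sigma_measurable. Qed.

Lemma path_cyl v (J : {fset I}) (B : I -> set R) :
  shifted v @^-1` (\bigcap_(j in [set` J]) co j @^-1` B j) =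
  \bigcap_(j in [set` J]) X (j + v) @^-1` B j.
Proof. by rewrite preimage_bigcap. Qed.

Lemma path_cylE v (J : {fset I}) (B : I -> set R) :
  \bigcap_(j in [set` J]) X (j + v) @^-1` B j =
  \bigcap_(i in [set` [fset (j + v)%R | j in J]%fset]) X i @^-1` B (i - v).
Proof.
apply/seteqP; split => [w h i /= /imfsetP[j /= jJ ->]|w h j /= jJ].
  by rewrite addrK; exact: h.
have := h (j + v); rewrite /= addrK; apply.
by apply/imfsetP; exists j.
Qed.

Lemma prob_path_cyl v (J : {fset I}) (B : I -> set R) : (forall j, measurable (B j)) ->
  P (\bigcap_(j in [set` J]) X (j + v) @^-1` B j) =
  P (\bigcap_(j in [set` J]) X j @^-1` B j).
Proof.
move=> mB; rewrite (prob_cyl iX)// path_cylE [in LHS](prob_cyl iX)//.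
rewrite (perm_big [seq j + v | j <- J]) /=; last first.
  apply: uniq_perm; first exact: fset_uniq.
    by rewrite map_inj_uniq ?fset_uniq//; exact: addIr.
  move=> i; apply/imfsetP/mapP => -[j jJ ->]; by exists j.
rewrite big_map; apply: eq_bigr => j _; rewrite addrK; exact: lX.
Qed.

Lemma prod_sigma_cyl : @prod_sigma I R `<=` <<s cyl co setT >>.
Proof. exact: (@gen_sigma_cyl _ _ _ co setT). Qed.

Lemma cyl_prod_sigma (S : set I) : cyl co S `<=` @prod_sigma I R.
Proof.
move=> _ [J [B [JS mB ->]]].
rewrite -[prod_sigma _]/(@measurable _ (g_sigma_algebraType
  (\bigcup_(i in [set: I]) [set co i @^-1` B | B in [set B : set R | measurable B]])) _).
apply: fin_bigcap_measurable => // j _.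
exact: (@gen_sigmaP _ _ _ co setT).
Qed.

Lemma path_law v A : prod_sigma A -> P (shifted v @^-1` A) = P (shifted 0 @^-1` A).
Proof.
move=> gA.
pose G := \bigcup_(i in [set: I]) [set co i @^-1` B | B in [set B : set R | measurable B]].
have mp u : measurable_fun setT (shifted u : Omega -> g_sigma_algebraType G).
  by move=> _ B mB; rewrite setTI; exact: path_measurable.
pose shiftedG u : Omega -> g_sigma_algebraType G := shifted u.
pose Xp u : {mfun Omega >-> g_sigma_algebraType G} :=
  HB.pack (shiftedG u) (@isMeasurableFun.Build _ _ Omega (g_sigma_algebraType G) (shiftedG u) (mp u)).
pose m u := distribution P (Xp u).
apply: (@g_sigma_algebra_measure_unique _ R (g_sigma_algebraType G) (cyl co setT) _
  (fun=> setT) _ _ (m v) (m 0)).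
- exact: cyl_prod_sigma.
- by move=> _; exact: cylT.
- by rewrite bigcup_const//; exists 0%N.
- exact: cylI.
- move=> _ [J [B [_ mB ->]]].
  rewrite -[LHS]/(P (shifted v @^-1` _)) -[RHS]/(P (shifted 0 @^-1` _)) !path_cyl.
  rewrite prob_path_cyl//; congr (P _); apply: eq_bigcapr => j _.
  by rewrite addr0.
- move=> _; rewrite -[X in (X < _)%E]/(P (shifted v @^-1` setT)) preimage_setT.
  by rewrite probability_setT ltry.
- exact: prod_sigma_cyl.
Qed.

Variable v : I.
Hypothesis escape : forall J1 J2 : {fset I},
  exists N, forall n j, (N <= n)%N -> j \in J2 -> j + v *+ n \notin J1.

Let mu A := fine (P A).

(** Asymptotic independence of a fixed event C and the shifts of B. Membership of B in the product
    sigma-algebra is included so that these B form a lambda-system. *)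
Let mixing_for (C : set Omega) (B : set (I -> R)) := prod_sigma B /\
  forall e, 0 < e -> exists N, forall n, (N <= n)%N ->
    `|mu (C `&` shifted (v *+ n) @^-1` B) - mu C * mu (shifted 0 @^-1` B)| <= e.

Let muE A : measurable A -> P A = (mu A)%:E.
Proof. by move=> mA; rewrite fineK// fin_num_measure. Qed.

Let le_mu A B : measurable A -> measurable B -> A `<=` B -> mu A <= mu B.
Proof.
by move=> mA mB AB; rewrite -lee_fin -!muE//; apply: le_measure; rewrite ?inE.
Qed.

Let muD A B : measurable A -> measurable B -> B `<=` A -> mu (A `\` B) = mu A - mu B.
Proof.
move=> mA mB BA; apply: EFin_inj; rewrite EFinB -!muE//; last exact: measurableD.
by rewrite measureD// ?ltey_eq ?fin_num_measure// setIidr.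
Qed.

Let prod_sigmaD A B : prod_sigma A -> prod_sigma B -> prod_sigma (A `\` B : set (I -> R)).
Proof.
move=> gA gB.
pose G := \bigcup_(i in [set: I]) [set co i @^-1` B | B in [set B : set R | measurable B]].
exact: (@measurableD _ (g_sigma_algebraType G)).
Qed.

(** For B a cylinder the covariance is exactly 0 once the shifted indices have left those of C. The
    general case follows by the pi-lambda theorem. *)
Lemma mixing_cyl C B : cyl X setT C -> prod_sigma B -> mixing_for C B.
Proof.
move=> CX gB.
have mC : measurable C by exact: cyl_measurable CX.
have mp n D : prod_sigma D -> measurable (shifted (v *+ n) @^-1` D) by exact: path_measurable.
have mp0 D : prod_sigma D -> measurable (shifted 0 @^-1` D) by exact: path_measurable.
have mupn n D : prod_sigma D -> mu (shifted (v *+ n) @^-1` D) = mu (shifted 0 @^-1` D).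
  by move=> gD; rewrite /mu path_law.
have C0 : 0 <= mu C by rewrite fine_ge0.
have C1 : mu C <= 1 by rewrite -lee_fin -muE// probability_le1.
suff : <<s cyl co setT >> `<=` mixing_for C by apply; exact: prod_sigma_cyl.
apply: (lambda_system_subset (@cylI _ _ _ co setT)) => //; last first.
  move=> D [J2 [E [_ mE DE]]].
  have gD : prod_sigma D by apply: (@cyl_prod_sigma setT); exists J2, E; split.
  split=> // e e0; have [J1 [F [_ mF CF]]] := CX.
  have [N HN] := escape J1 J2; exists N => n Nn.
  have -> : mu (C `&` shifted (v *+ n) @^-1` D) = mu C * mu (shifted (v *+ n) @^-1` D).
    rewrite /mu -fineM ?fin_num_measure//; last exact: mp.
    congr fine; apply: (indep_cyl iX (S := [set` J1]) (T := [set i | i - v *+ n \in J2])).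
    - rewrite -subset0 => i [/= i1 i2]; have := HN n _ Nn i2.
      by rewrite subrK i1.
    - by exists J1, F; split.
    - rewrite DE path_cyl path_cylE; exists [fset (j + v *+ n)%R | j in J2]%fset.
      exists (fun i => E (i - v *+ n)); split => //.
      by move=> j /imfsetP[i /= iJ ->]; rewrite /= addrK.
  by rewrite mupn// subrr normr0 ltW.
split=> //.
- split=> [|e e0].
    by apply: (@cyl_prod_sigma setT); exact: cylT.
  exists 0%N => n _; rewrite !preimage_setT setIT /mu probability_setT mulr1.
  by rewrite subrr normr0 ltW.
- move=> A D DA [gA mA] [gD mD]; split; first exact: prod_sigmaD.
  move=> e e0; have e20 : 0 < e / 2 by rewrite divr_gt0.
  have [N1 H1] := mA _ e20; have [N2 H2] := mD _ e20.
  exists (maxn N1 N2) => n; rewrite geq_max => /andP[/H1 h1 /H2 h2].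
  have pA := mp n _ gA; have pD := mp n _ gD.
  have -> : C `&` shifted (v *+ n) @^-1` (A `\` D) =
      (C `&` shifted (v *+ n) @^-1` A) `\` (C `&` shifted (v *+ n) @^-1` D).
    apply/seteqP; split => [w [Cw [Aw Dw]]|w [[Cw Aw] Dw]].
      by split => // -[].
    by split=> //; split => // Dw'; apply: Dw.
  rewrite muD; [|exact: measurableI|exact: measurableI|by move=> w [Cw /DA Aw]].
  rewrite (_ : shifted 0 @^-1` (A `\` D) = shifted 0 @^-1` A `\` shifted 0 @^-1` D)//.
  rewrite muD; [|exact: mp0|exact: mp0|by move=> w /DA].
  move: h1 h2; rewrite !ler_norml => /andP[h1 h1'] /andP[h2 h2'].
  by rewrite mulrBr; apply/andP; split; lra.
- move=> F ndF GF; have gF i : prod_sigma (F i) by case: (GF i).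
  have gU : prod_sigma (\bigcup_i F i).
    pose G := \bigcup_(i in [set: I]) [set co i @^-1` B | B in [set B : set R | measurable B]].
    exact: (@bigcupT_measurable _ (g_sigma_algebraType G)).
  split=> // e e0; have e20 : 0 < e / 2 by rewrite divr_gt0.
  have FU i : F i `<=` \bigcup_i F i by exact: bigcup_sup.
  (* The law of the path does not depend on the shift, so an approximation of the union within e / 2
     at shift 0 is equally good at every shift, uniformly in n. *)
  have [i Hi] : exists i, mu (shifted 0 @^-1` (\bigcup_i F i)) - mu (shifted 0 @^-1` F i) <= e / 2.
    have nd : nondecreasing_seq (fun i => shifted 0 @^-1` F i).
      move=> a b ab; apply/subsetPset => w; have /subsetPset := ndF _ _ ab; exact.
    have E : \bigcup_i (shifted 0 @^-1` F i) = shifted 0 @^-1` (\bigcup_i F i).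
      by rewrite preimage_bigcup.
    have : (P \o (fun i => shifted 0 @^-1` F i)) @ \oo --> P (shifted 0 @^-1` (\bigcup_i F i)).
      rewrite -E; apply: nondecreasing_cvg_mu => //; first by move=> i; exact: mp0.
      by rewrite E; exact: mp0.
    rewrite (muE (mp0 _ gU)).
    move=> /fine_cvgP[_] /cvgr_gt h.
    have [i _ /(_ i (leqnn i)) /= hi] := h (mu (shifted 0 @^-1` (\bigcup_i F i)) - e / 2)
      ltac:(by rewrite ltrBlDr ltrDl).
    exists i; move: hi; rewrite -/(mu _); lra.
  have [_ mix] := GF i.
  have [N HN] := mix _ e20; exists N => n /HN.
  have pU := mp n _ gU; have pF := mp n _ (gF i).
  have h1 : mu (C `&` shifted (v *+ n) @^-1` F i) <= mu (C `&` shifted (v *+ n) @^-1` (\bigcup_i F i)).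
    by apply: le_mu; [exact: measurableI|exact: measurableI|move=> w [Cw Fw]; split => //; exact: FU Fw].
  have h2 : mu (C `&` shifted (v *+ n) @^-1` (\bigcup_i F i)) - mu (C `&` shifted (v *+ n) @^-1` F i)
      <= mu (shifted 0 @^-1` (\bigcup_i F i)) - mu (shifted 0 @^-1` F i).
    rewrite -!(mupn n)// -!muD//; try exact: measurableI.
    - apply: le_mu; [by apply: measurableD; exact: measurableI|exact: measurableD|].
      by move=> w [[Cw Uw] nF]; split => // Fw; apply: nF.
    - by move=> w Fw; exact: FU Fw.
    - by move=> w [Cw Fw]; split => //; exact: FU Fw.
  have h3 : mu (shifted 0 @^-1` F i) <= mu (shifted 0 @^-1` (\bigcup_i F i)).
    by apply: le_mu; [exact: mp0|exact: mp0|move=> w Fw; exact: FU Fw].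
  move: h1 h2 h3 Hi; move: (mu (C `&` _)) (mu (C `&` _)) (mu (shifted 0 @^-1` _)) (mu (shifted 0 @^-1` _)).
  move=> aU aF mF mU h1 h2 h3 Hi; rewrite !ler_norml => /andP[h4 h5].
  have : 0 <= mu C * (mU - mF) by rewrite mulr_ge0// subr_ge0.
  have : mu C * (mU - mF) <= 1 * (mU - mF) by rewrite ler_wpM2r// subr_ge0.
  by rewrite mulrBr mul1r => h6 h7; apply/andP; split; lra.
Qed.

(** Invariance makes the shifted event constantly A, so mixing gives independence of A from every
    cylinder, then from the whole sigma-algebra, and so from itself: P(A) = P(A)^2. *)
Lemma invariant_trivial B : prod_sigma B -> (forall w n, B (shifted (v *+ n) w) <-> B (shifted 0 w)) ->
  P (shifted 0 @^-1` B) = 0%E \/ P (shifted 0 @^-1` B) = 1%E.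
Proof.
move=> gB invB.
set A := shifted 0 @^-1` B.
have mA : measurable A by exact: path_measurable.
have key C : cyl X setT C -> P (C `&` A) = (P C * P A)%E.
  move=> cC; have mC : measurable C by exact: cyl_measurable cC.
  have [_ mix] := mixing_cyl cC gB.
  rewrite !muE//; last exact: measurableI.
  rewrite -EFinM; congr EFin; apply/eqP; rewrite -subr_eq0 -normr_le0.
  apply/ler_addgt0Pr => e e0; rewrite add0r; have [N /(_ N (leqnn N))] := mix e e0.
  by rewrite (_ : shifted (v *+ N) @^-1` B = A)//; apply/seteqP; split => w /=; rewrite invB.
have : P (A `&` A) = (P A * P A)%E.
  apply: (indep_sigma (F := cyl X setT)) => //.
  - exact: cyl_measurable.
  - exact: cylI.
  - exact: cylT.
  - by apply: gen_sigma_cyl; exact: path_gen.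
rewrite setIid muE// -EFinM => -[]; set a := mu A => aa.
have : a * (1 - a) = 0 by rewrite mulrBr mulr1 -aa subrr.
by move=> /eqP; rewrite mulf_eq0 subr_eq0 => /orP[/eqP ->|/eqP <-]; [left|right].
Qed.

End ShiftErgodicity.

(** * The stationary solution *)

Section SameLaw.
Context (dO : measure_display) (Omega : measurableType dO) (R : realType)
  (P : probability Omega R) (X Y : Omega -> R).
Hypothesis mX : measurable_fun setT X.
Hypothesis mY : measurable_fun setT Y.
Hypothesis XY : forall B, measurable B -> P (X @^-1` B) = P (Y @^-1` B).

Let X' : {mfun Omega >-> R} := HB.pack X (isMeasurableFun.Build _ _ _ _ X mX).
Let Y' : {mfun Omega >-> R} := HB.pack Y (isMeasurableFun.Build _ _ _ _ Y mY).

Let lawE (f : R -> \bar R) :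
  (\int[distribution P X']_x f x = \int[distribution P Y']_x f x)%E.
Proof. by apply: eq_measure_integral => A mA _; exact: XY. Qed.

Lemma same_law_ge0 (f : R -> \bar R) : measurable_fun setT f -> (forall x, 0 <= f x)%E ->
  (\int[P]_w f (X w) = \int[P]_w f (Y w))%E.
Proof.
move=> mf f0.
have := ge0_integral_distribution (P := P) X' mf f0; have := ge0_integral_distribution (P := P) Y' mf f0.
by rewrite lawE => -> /esym.
Qed.

Lemma same_law_integrable (f : R -> R) : measurable_fun setT f ->
  P.-integrable setT (EFin \o (f \o X)) -> P.-integrable setT (EFin \o (f \o Y)).
Proof.
move=> mf /integrableP[_ fX]; apply/integrableP; split.
  by apply/measurable_EFinP; exact: measurableT_comp.
rewrite -(@same_law_ge0 (fun x => `|(f x)%:E|%E))//.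
by apply: measurableT_comp => //; exact/measurable_EFinP.
Qed.

Lemma same_law_integral (f : R -> R) : measurable_fun setT f ->
  P.-integrable setT (EFin \o (f \o X)) ->
  \int[P]_w f (X w) = \int[P]_w f (Y w).
Proof.
move=> mf fX; have fY := same_law_integrable mf fX.
have mf' : measurable_fun setT (EFin \o f) by exact/measurable_EFinP.
have := @integral_distribution _ _ _ _ _ P X' (EFin \o f) mf' fX.
have := @integral_distribution _ _ _ _ _ P Y' (EFin \o f) mf' fY.
by rewrite lawE /Rintegral => -> /= ->.
Qed.

End SameLaw.

Section LimitMeasurable.
Context (dT : measure_display) (T : measurableType dT) (R : realType).
Variable u : nat -> T -> R.
Hypothesis mu_ : forall n, measurable_fun setT (u n).

(** Cauchy's criterion with countable quantifiers, whence the set of convergence is measurable. *)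
Lemma cvgn_setE : [set w | cvgn (u^~ w)] =
  \bigcap_i \bigcup_m \bigcap_j
    ((fun w => `|u m w - u (m + j) w|) @^-1` `]-oo, (i.+1%:R^-1 : R)[%classic).
Proof.
apply/seteqP; split => w /=.
  move=> /cvg_ex[l ul] i _.
  have e0 : 0 < (i.+1%:R^-1 / 2 : R) by rewrite divr_gt0 ?invr_gt0.
  have /cvgrPdist_lt /(_ _ e0) [m _ Hm] := ul.
  exists m => // j _ /=; rewrite in_itv /=.
  have h1 := Hm _ (leqnn m); have h2 := Hm (m + j)%N (leq_addr _ _).
  move: h1 h2; rewrite /= => h1 h2.
  rewrite (_ : u m w - _ = - (l - u m w) + (l - u (m + j) w)); last by ring.
  by rewrite (le_lt_trans (ler_normD _ _))// normrN [ltRHS]splitr ltrD.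
move=> h; apply/cauchy_cvgP; apply: cauchy_exP => e e0.
have [i ie] : exists i : nat, i.+1%:R^-1 < e.
  exists (Num.truncn e^-1); rewrite invf_plt ?posrE//.
  exact: truncnS_gt.
have [m _ Hm] := h i I; exists (u m w); exists m => // n /= mn.
have := Hm (n - m)%N I; rewrite /= in_itv /= subnKC// /ball /= => h'.
exact: lt_trans h' ie.
Qed.

Lemma measurable_lim : measurable_fun setT
  (fun w => if pselect (cvgn (u^~ w)) then limn (u^~ w) else 0).
Proof.
have mD : measurable [set w | cvgn (u^~ w)].
  rewrite cvgn_setE; apply: bigcapT_measurable => i; apply: bigcupT_measurable => m.
  apply: bigcapT_measurable => j; rewrite -[X in measurable X]setTI.
  by apply: measurableT_comp => //; apply: measurable_funB.
have : measurable_fun [set w | cvgn (u^~ w)] (fun w => limn (u^~ w)).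
  apply: (measurable_fun_cvg (h := u)) => [m|w /= cw]; last exact: cw.
  exact: measurable_funTS.
move=> /(measurable_restrictT _ mD); apply: eq_measurable_fun => w _.
rewrite patchE; case: pselect => /= cw; last by rewrite memNset.
by rewrite mem_set.
Qed.

End LimitMeasurable.

(** * The series as an equivariant function of the noise *)

Section ChiField.
Variables (R : realType) (d : nat) (p : 'rV[int]_d -> R).
Notation Zd := 'rV[int]_d.
Variable s : seq Zd.
Hypothesis s_uniq : uniq s.
Hypothesis s_supp : forall x, p x != 0 -> x \in s.

Lemma measurable_iter_avg dT (T : measurableType dT) (F : Zd -> T -> R) k x :
  (forall z, measurable_fun setT (F z)) ->
  measurable_fun setT (fun w => iter k (avg p) (fun z => F z w) x).
Proof.
move=> mF; elim: k x => [|k IH] x; first exact: mF.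
under eq_fun do rewrite iterS (avgE s_uniq s_supp).
by apply: measurable_sum => z; exact: measurable_funM.
Qed.

Lemma SpartE (Omega : Type) (xi : int -> Zd -> Omega -> R) n t x w :
  Spart p xi n t x w = \sum_(k < n) iter k (avg p) (fun z => xi (t - k%:Z) z w) x.
Proof. by apply: eq_bigr => k _; rewrite (fsum_pk s_uniq s_supp). Qed.

(** The sigma-algebra is left free, with a condition on the times up to t only. It is later taken to
    be that of [Omega], that of the past noise, and that of the path space. *)
Lemma measurable_chi dT (T : measurableType dT) (xi : int -> Zd -> T -> R) t x :
  (forall r z, r <= t -> measurable_fun setT (xi r z)) ->
  measurable_fun setT (chi p xi t x).
Proof.
move=> mxi; apply: measurable_lim => n.
rewrite (_ : Spart _ _ _ _ _ = (fun w => \sum_(k < n) iter k (avg p)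
    (fun z => xi (t - k%:Z) z w) x)); last first.
  by apply/funext => w; rewrite SpartE.
apply: measurable_sum => k; apply: measurable_iter_avg => z.
by apply: mxi; lia.
Qed.

(** Holds for every field f, convergent or not, because the two sequences of partial sums coincide
    and so does the default value. *)
Lemma chi_shift (t : int) (y : Zd) (f : int * Zd -> R) r x :
  chi p (fun r z g => g (r, z)) r x (st_shift y t f) =
  chi p (fun r z (g : int * Zd -> R) => g (r, z)) (r + t) (x + y) f.
Proof.
rewrite /chi.
suff -> : (fun n => Spart p (fun r z g => g (r, z)) n r x (st_shift y t f)) =
  (fun n => Spart p (fun r z (g : int * Zd -> R) => g (r, z)) n (r + t) (x + y) f) by [].
apply/funext => n; rewrite !SpartE; apply: eq_bigr => k _.
rewrite (iter_avg_shift s_uniq s_supp); congr (iter _ _ _ _).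
by apply/funext => z; rewrite /st_shift /= addrAC.
Qed.

Lemma chi_recursion (Omega : Type) (xi : int -> Zd -> Omega -> R) w :
  (forall t x, cvgn (fun n => Spart p xi n t x w)) ->
  forall t x, chi p xi (t + 1) x w = avg p (fun y => chi p xi t y w) x + xi (t + 1) x w.
Proof.
move=> cS t x.
have chiE t' x' : chi p xi t' x' w = limn (fun n => Spart p xi n t' x' w).
  by rewrite /chi; case: pselect => // h; case: (h (cS _ _)).
rewrite chiE; apply/cvg_lim => //.
rewrite -(cvg_shiftn 1%N).
(* The term k = 0 at time t + 1 is the new noise. The term k + 1 is the average of the term k at
   time t, hence the shift of the number of terms by one. *)
have -> : (fun n => Spart p xi (n + 1)%N (t + 1) x w) =
    (fun n => \sum_(z <- s) p z * Spart p xi n t (x + z) w + xi (t + 1) x w).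
  apply/funext => n; rewrite addn1 SpartE big_ord_recl /= subr0 addrC; congr (_ + _).
  under [RHS]eq_bigr do rewrite SpartE mulr_sumr.
  rewrite exchange_big; apply: eq_bigr => k _ /=.
  rewrite add0n (_ : t + 1 - (bump 0 k)%:Z = t - k%:Z); last by rewrite /bump; lia.
  by rewrite (avgE s_uniq s_supp).
apply: cvgD; last exact: cvg_cst.
rewrite (avgE s_uniq s_supp); apply: cvg_big => //; first exact: add_continuous.
move=> z _; apply: cvgMl_tmp; rewrite chiE; exact: cS.
Qed.

End ChiField.

Section Orthogonality.
Context (dO : measure_display) (Omega : measurableType dO) (R : realType)
  (P : probability Omega R).

Lemma Rintegral_sum (J : Type) (r : seq J) (F : J -> Omega -> R) :
  (forall j, P.-integrable setT (EFin \o F j)) ->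
  P.-integrable setT (EFin \o (fun w => \sum_(j <- r) F j w)) /\
  \int[P]_w (\sum_(j <- r) F j w) = \sum_(j <- r) \int[P]_w F j w.
Proof.
move=> iF; elim: r => [|j r [iS IH]].
  under [fun w => _]eq_fun do rewrite big_nil.
  split; first exact: finite_measure_integrable_cst.
  by rewrite Rintegral_cst// mul0r big_nil.
under [fun w => _]eq_fun do rewrite big_cons.
split; first exact: integrable_EFinD.
by rewrite RintegralD// IH big_cons.
Qed.

Context (J : eqType) (Z : J -> Omega -> R) (sigma2 : R).
Hypothesis Z_sq : forall j, sqint P (Z j).
Hypothesis Z_orth : forall i j, i != j -> \int[P]_w (Z i w * Z j w) = 0.
Hypothesis Z_var : forall j, \int[P]_w (Z j w ^+ 2) = sigma2.

Lemma orth_sum_L2 (r : seq J) (c : J -> R) : uniq r ->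
  \int[P]_w ((\sum_(j <- r) c j * Z j w) ^+ 2) = sigma2 * \sum_(j <- r) c j ^+ 2.
Proof.
elim: r => [_|i r IH /= /andP[ir ur]].
  under eq_Rintegral do rewrite big_nil expr0n /=.
  by rewrite Rintegral_cst// mul0r big_nil mulr0.
have sT : sqint P (fun w => \sum_(j <- r) c j * Z j w).
  by apply: sqint_sum => j; exact: sqintZ.
have cross : \int[P]_w (Z i w * \sum_(j <- r) c j * Z j w) = 0.
  under eq_Rintegral do rewrite mulr_sumr.
  rewrite (Rintegral_sum r _).2; last by move=> j; apply: sqint_mul => //; exact: sqintZ.
  rewrite big_seq big1// => j jr.
  under eq_Rintegral do rewrite mulrCA.
  rewrite RintegralZl//; last exact: sqint_mul.
  by rewrite Z_orth ?mulr0//; apply: contraNneq ir => ->.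
have -> : \int[P]_w ((\sum_(j <- i :: r) c j * Z j w) ^+ 2) =
    \int[P]_w (c i ^+ 2 * Z i w ^+ 2 + 2 * c i * (Z i w * \sum_(j <- r) c j * Z j w)
      + (\sum_(j <- r) c j * Z j w) ^+ 2).
  by apply: eq_Rintegral => w _; rewrite big_cons; ring.
have iZ2 : P.-integrable setT (EFin \o (fun w => Z i w ^+ 2)) by case: (Z_sq i).
have iZT := sqint_mul (Z_sq i) sT.
rewrite RintegralD//; last by case: sT.
  rewrite RintegralD//; try exact: integrable_EFinZ.
  rewrite !RintegralZl// cross mulr0 addr0 Z_var IH// big_cons; ring.
by apply: integrable_EFinD; exact: integrable_EFinZ.
Qed.

End Orthogonality.

(** * Convergence, Markov property and ergodicity of the stationary field *)

Section StationarySolution.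
Variables (R : realType) (d : nat) (p : 'rV[int]_d -> R).
Notation Zd := 'rV[int]_d.
Variable s : seq Zd.
Hypothesis s_uniq : uniq s.
Hypothesis s_supp : forall x, p x != 0 -> x \in s.
Variable V : R.
Hypothesis collision_le : forall n, \sum_(k < n) collision p k <= V.

Context (dO : measure_display) (Omega : measurableType dO)
  (P : probability Omega R) (xi : int -> Zd -> Omega -> R).
Notation I := (int * Zd)%type.
Let X (i : I) := xi i.1 i.2.
Hypothesis xi_iid : iid P X.
Hypothesis xi_mean : ('E_P[xi 0%R 0%R] = 0)%E.
Hypothesis xi_sq : xi 0 0 \in Lfun P 2%:E.

Let mX i : measurable_fun setT (X i). Proof. by case: xi_iid. Qed.
Let iX : indep_family P (fun i => gen_sigma X [set i]). Proof. by case: xi_iid. Qed.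
Let lX i j B : measurable B -> P (X i @^-1` B) = P (X j @^-1` B).
Proof. by case: xi_iid => _ _; apply. Qed.

Let X0_sq : sqint P (X 0).
Proof. by split=> //; exact: Lfun2_integrable_sqr. Qed.

Let X_sq i : sqint P (X i).
Proof.
split=> //; apply: (@same_law_integrable _ _ _ P (X 0) (X i) _ _ _ (fun x => x ^+ 2)) => //.
- by move=> B; exact: lX.
- by case: X0_sq.
Qed.

Let X_mean i : \int[P]_w X i w = 0.
Proof.
rewrite -(@same_law_integral _ _ _ P (X 0) (X i) _ _ _ id)//; last 2 first.
- by move=> B; exact: lX.
- exact: sqint_integrable X0_sq.
by have := xi_mean; rewrite unlock /Rintegral /= => ->.
Qed.

Let sigma2 := \int[P]_w (X 0 w ^+ 2).

Let X_var i : \int[P]_w (X i w ^+ 2) = sigma2.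
Proof.
rewrite -(@same_law_integral _ _ _ P (X 0) (X i) _ _ _ (fun x => x ^+ 2))//.
- by move=> B; exact: lX.
- by case: X0_sq.
Qed.

Let sigma2_ge0 : 0 <= sigma2.
Proof. by apply: Rintegral_ge0 => w _; exact: sqr_ge0. Qed.

Let X_orth i j : i != j -> \int[P]_w (X i w * X j w) = 0.
Proof.
move=> ij.
have ind : indep_rv P (X i) (X j).
  move=> A B mA mB; apply: (indep_cyl iX (S := [set i]) (T := [set j])).
  - by rewrite -subset0 => k [/= -> /eqP]; rewrite (negbTE ij).
  - exact: cyl1.
  - exact: cyl1.
have h := integral_indepM (mX i) (mX j) ind (sqint_integrable (X_sq i)) (sqint_integrable (X_sq j)).
rewrite /Rintegral h fineM; try by apply: integrable_fin_num => //; exact: sqint_integrable.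
by rewrite [X in X * _](X_mean i) mul0r.
Qed.

Section FixedPoint.
Variables (t : int) (x : Zd).

Let Y k w := iter k (avg p) (fun z => xi (t - k%:Z) z w) x.

(** The terms run backwards in time: term k uses the noise at time t - k, and the terms before it
    use strictly later times. *)
Let C k : set (set Omega) := \bigcup_(i in [set i : I | t - k%:Z < i.1])
  [set X i @^-1` B | B in [set B : set R | measurable B]].

Let gen_meas (S : set I) i : S i -> measurable_fun [set: g_sigma_algebraType
  (\bigcup_(i in S) [set X i @^-1` B | B in [set B : set R | measurable B]])] (X i).
Proof. by move=> Si _ B mB; rewrite setTI; exact: gen_sigmaP. Qed.

Let YE k : exists r : seq Zd, [/\ uniq r,
  forall w, Y k w = \sum_(z <- r) pk p k x z * X (t - k%:Z, z) w &
  \sum_(z <- r) pk p k x z ^+ 2 = collision p k].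
Proof.
have [r0 r0P] := pk_fin s_uniq s_supp k x; exists (undup r0); split.
- exact: undup_uniq.
- move=> w; rewrite /Y -(fsum_pk s_uniq s_supp) (@fsum_seq _ _ (undup r0)) ?undup_uniq//.
    by apply: eq_bigr => z _; rewrite mulrC.
  move=> z; apply: contraNT; rewrite mem_undup => zr.
  have /eqP -> : pk p k x z == 0 by apply: contraNT zr => /r0P.
  by rewrite mulr0.
- rewrite -(collisionE s_uniq s_supp k x) (@fsum_seq _ _ (undup r0)) ?undup_uniq//.
  move=> z; rewrite mem_undup => z0; apply: r0P.
  by apply: contra z0 => /eqP ->; rewrite expr0n.
Qed.

Let Y_sq k : sqint P (Y k).
Proof.
have [r [_ YE' _]] := YE k; rewrite (_ : Y k = (fun w => \sum_(z <- r) pk p k x z * X (t - k%:Z, z) w)).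
  by apply: sqint_sum => z; exact: sqintZ.
by apply/funext.
Qed.

Let Y_mean k : \int[P]_w Y k w = 0.
Proof.
have [r [_ YE' _]] := YE k; under eq_Rintegral do rewrite YE'.
rewrite (Rintegral_sum r _).2; last first.
  by move=> z; apply: integrable_EFinZ; exact: sqint_integrable.
rewrite big1// => z _; rewrite RintegralZl// ?X_mean ?mulr0//.
exact: sqint_integrable.
Qed.

Let Y_L2 k : \int[P]_w (Y k w ^+ 2) = sigma2 * collision p k.
Proof.
have [r [ur YE' <-]] := YE k; under eq_Rintegral do rewrite YE'.
apply: (@orth_sum_L2 _ _ _ P _ (fun z => X (t - k%:Z, z)) sigma2) => // z z' zz'.
by apply: X_orth; apply: contraNneq zz' => -[->].
Qed.

Let C_meas k : C k `<=` measurable.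
Proof.
move=> _ [i _ [B mB <-]]; exact: measurable_preimage.
Qed.

Let C_incr k : <<s C k >> `<=` <<s C k.+1 >>.
Proof.
apply: (@gen_sigma_sub _ _ _ X [set i : I | t - k%:Z < i.1]).
  exact: smallest_sigma_algebra.
move=> i B /= ik mB; apply: (@gen_sigmaP _ _ _ X [set i : I | t - k.+1%:Z < i.1]) => //=.
by lia.
Qed.

Let Y_meas k : measurable_fun [set: g_sigma_algebraType (C k.+1)] (Y k).
Proof.
apply: (@measurable_iter_avg _ _ _ _ s_uniq s_supp _ (g_sigma_algebraType (C k.+1))
  (fun z => X (t - k%:Z, z))) => z.
by apply: gen_meas => /=; lia.
Qed.

Let Y_indep k A B : <<s C k >> A -> measurable B ->
  P (A `&` Y k @^-1` B) = (P A * P (Y k @^-1` B))%E.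
Proof.
move=> CA mB.
pose S := [set i : I | i.1 = t - k%:Z].
pose D : set (set Omega) := \bigcup_(i in S) [set X i @^-1` B | B in [set B : set R | measurable B]].
have mY : measurable_fun [set: g_sigma_algebraType D] (Y k).
  apply: (@measurable_iter_avg _ _ _ _ s_uniq s_supp _ (g_sigma_algebraType D)
    (fun z => X (t - k%:Z, z))) => z.
  exact: (@gen_meas S).
apply: (indep_disjoint mX iX (S := [set i : I | t - k%:Z < i.1]) (T := S)) => //.
  by rewrite -subset0 => i [/= + iE]; rewrite iE ltxx.
exact: (filt_preimage mY mB).
Qed.

Let u n := \sum_(k < n) collision p k.

Let u_cvg : cvgn u.
Proof.
apply: nondecreasing_is_cvgn.
  apply/nondecreasing_seqP => n; rewrite /u big_ord_recr /= lerDl; exact: collision_ge0.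
by exists V => _ [n _ <-]; exact: collision_le.
Qed.

Let u_nd : nondecreasing_seq u.
Proof.
by apply/nondecreasing_seqP => n; rewrite /u big_ord_recr /= lerDl; exact: collision_ge0.
Qed.

(** The tail of the series of variances. *)
Let r m := sigma2 * (limn u - u m).

Let r_tail m n : \sum_(k < n) \int[P]_w (Y (m + k)%N w ^+ 2) <= r m.
Proof.
under eq_bigr do rewrite Y_L2.
rewrite -mulr_sumr; apply: ler_wpM2l => //; rewrite lerBrDl.
have -> : u m + \sum_(k < n) collision p (m + k) = u (m + n)%N.
  by rewrite /u big_split_ord.
exact: nondecreasing_cvgn_le.
Qed.

Let r_cvg0 : r @ \oo --> 0.
Proof.
rewrite -(mulr0 sigma2) -(subrr (limn u)); apply: cvgMl_tmp.
by apply: cvgB; [exact: cvg_cst|exact: u_cvg].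
Qed.

Let SY n w : Spart p xi n t x w = \sum_(k < n) Y k w.
Proof. exact: (SpartE s_uniq s_supp). Qed.

Lemma chi_series_ae_cvg : {ae P, forall w, cvgn (fun n => Spart p xi n t x w)}.
Proof.
have := series_ae_cvg C_meas C_incr Y_meas Y_sq Y_mean Y_indep r_tail r_cvg0.
by apply: filterS => w; under eq_fun do rewrite -SY.
Qed.

Lemma chi_measurable : measurable_fun setT (chi p xi t x).
Proof. by apply: (measurable_chi s_uniq s_supp) => r' z _; exact: (mX (r', z)). Qed.

Lemma chi_series_L2 :
  (fun n => (\int[P]_w ((Spart p xi n t x w - chi p xi t x w) ^+ 2)%:E)%E) @ \oo --> 0%E.
Proof.
apply: (@squeeze_cvge _ _ _ _ (cst 0%E) _ (fun n => (r n)%:E)).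
- apply: nearW => n; rewrite integral_ge0 /=; last by move=> w _; rewrite lee_fin sqr_ge0.
  have := @series_L2 _ _ _ P C C_meas C_incr Y Y_meas Y_sq Y_mean Y_indep r r_tail
    (chi p xi t x) n chi_measurable.
  under eq_integral do rewrite -SY.
  apply; apply: filterS chi_series_ae_cvg => w.
  by rewrite /chi; case: pselect => // h _; under eq_fun do rewrite -SY.
- exact: cvg_cst.
- by apply: cvg_EFin => //; exact: nearW.
Qed.

End FixedPoint.

Lemma ae_countable (J : countType) (Q : J -> Omega -> Prop) :
  (forall j, {ae P, forall w, Q j w}) -> {ae P, forall w, forall j, Q j w}.
Proof.
move=> h.
have : {ae P, forall w, forall n, if @choice.unpickle J n is Some j then Q j w else True}.
  apply: ae_foralln => n; case: choice.unpickle => [j|]; first exact: h.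
  exact: filterE.
by apply: filterS => w hw j; have := hw (choice.pickle j); rewrite choice.pickleK.
Qed.

Lemma chi_ae_cvg : {ae P, forall w, forall t x, cvgn (fun n => Spart p xi n t x w)}.
Proof.
have := @ae_countable (int * Zd)%type (fun i w => cvgn (fun n => Spart p xi n i.1 i.2 w)).
move=> /(_ (fun i => chi_series_ae_cvg i.1 i.2)).
by apply: filterS => w h t x; exact: (h (t, x)).
Qed.

Lemma chi_past_gen t :
  gen_sigma (fun sy : I => chi p xi sy.1 sy.2) [set sy | sy.1 <= t] `<=`
  gen_sigma X [set i | i.1 <= t].
Proof.
apply: gen_sigma_sub; first exact: gen_sigma_sigma.
move=> i B /= it mB.
pose D : set (set Omega) := \bigcup_(i in [set i : I | i.1 <= t])
  [set X i @^-1` B | B in [set B : set R | measurable B]].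
have : measurable_fun [set: g_sigma_algebraType D] (chi p xi i.1 i.2).
  apply: (measurable_chi s_uniq s_supp) => r z ri _ B' mB'; rewrite setTI.
  by apply: (@gen_sigmaP _ _ _ X _ (r, z)) => //=; exact: le_trans ri it.
by move=> /filt_preimage; exact.
Qed.

(** The field up to time t is a function of the noise up to time t, which shares no index with the
    noise at t + 1. *)
Lemma chi_markov t :
  indep2 P (gen_sigma (fun sy : I => chi p xi sy.1 sy.2) [set sy | sy.1 <= t])
    (gen_sigma (xi (t + 1)) setT).
Proof.
move=> A B /chi_past_gen gA gB.
apply: (indep_disjoint mX iX (T := [set i : I | i.1 = t + 1]) _ gA).
  by rewrite -subset0 => i [/= + iE]; rewrite iE; lia.
move: gB; apply: gen_sigma_sub; first exact: gen_sigma_sigma.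
by move=> z B' _ mB'; apply: (@gen_sigmaP _ _ _ X _ (t + 1, z)).
Qed.

(** The solution map on path space. It turns questions about the law of [chi] into questions about
    the noise. *)
Let Phi (f : I -> R) : I -> R := fun sy => chi p (fun r z g => g (r, z)) sy.1 sy.2 f.

Let PhiE w : (fun sy : I => chi p xi sy.1 sy.2 w) = Phi (shifted X 0 w).
Proof.
have -> : shifted X 0 w = (fun i => X i w) by apply/funext => i; rewrite /shifted addr0.
by [].
Qed.

Let Phi_shift y t f : st_shift y t (Phi f) = Phi (st_shift y t f).
Proof. by apply/funext => -[r z]; rewrite /Phi /= (chi_shift s_uniq s_supp). Qed.

Let path_shift y t v w : st_shift y t (shifted X v w) = shifted X ((t, y) + v) w.
Proof. by apply/funext => -[r z]; rewrite /st_shift /shifted /= addrA. Qed.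

Let Phi_gen A : prod_sigma A -> prod_sigma (Phi @^-1` A).
Proof.
move=> /(@gen_sigma_preimage _ _ _ (fun sy f => Phi f sy)).
apply: gen_sigma_sub; first exact: smallest_sigma_algebra.
move=> i B _ mB.
pose D : set (set (I -> R)) := \bigcup_(i in [set: I])
  [set (fun f : I -> R => f i) @^-1` B | B in [set B : set R | measurable B]].
have : measurable_fun [set: g_sigma_algebraType D]
    (chi p (fun r z (g : I -> R) => g (r, z)) i.1 i.2).
  apply: (measurable_chi s_uniq s_supp) => r z _ _ B' mB'; rewrite setTI.
  exact: (@gen_sigmaP _ _ _ (fun (i : I) (f : I -> R) => f i) setT (r, z)).
by move=> /(_ measurableT B mB); rewrite setTI.
Qed.

Lemma chi_invariant x t A : prod_sigma A ->
  P ((fun w sy => chi p xi sy.1 sy.2 w) @^-1` (st_shift x t @^-1` A))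
  = P ((fun w sy => chi p xi sy.1 sy.2 w) @^-1` A).
Proof.
move=> /Phi_gen gA.
have -> : (fun w sy => chi p xi sy.1 sy.2 w) @^-1` (st_shift x t @^-1` A) =
   shifted X (t, x) @^-1` (Phi @^-1` A).
  by apply/seteqP; split => w /=; rewrite PhiE Phi_shift path_shift addr0.
rewrite (path_law mX iX lX)//; congr (P _).
by apply/seteqP; split => w /=; rewrite PhiE.
Qed.

Lemma shift_escape (v : I) : v != 0 -> forall J1 J2 : {fset I},
  exists N, forall n j, (N <= n)%N -> j \in J2 -> j + v *+ n \notin J1.
Proof.
move=> v0 J1 J2.
have [lam [lamD lamv]] : exists lam : I -> int,
    (forall a n, lam (a + v *+ n) = lam a + n%:Z * lam v) /\ lam v != 0.
  have [t0|t0] := eqVneq v.1 0; last first.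
    exists fst; split=> // a n; rewrite /= raddfMn /=.
    by rewrite -mulr_natl natz.
  have [i xi0] : exists i, v.2 ord0 i != 0.
    apply: contrapT => h; move: v0; case: v t0 h => t y /= -> h.
    move=> /eqP; apply; congr (_, _); apply/rowP => i; rewrite mxE.
    by apply/eqP/negP => /negP yi; apply: h; exists i.
  exists (fun a : I => a.2 ord0 i); split=> // a n.
  by rewrite /= mxE raddfMn /= mulmxnE -mulr_natl natz.
(* The additive coordinate [lam] has [lam v != 0], so it moves by at least n in absolute value and
   ends beyond all its values on [J1]. *)
exists (\sum_(j <- J1) absz (lam j) + \sum_(j <- J2) absz (lam j)).+1 => n j Nn j2.
apply/negP => j1.
have h1 : (absz (lam (j + v *+ n)%R) <= \sum_(j <- J1) absz (lam j))%N.
  by rewrite (big_rem _ j1) /= leq_addr.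
have h2 : (absz (lam j) <= \sum_(j <- J2) absz (lam j))%N.
  by rewrite (big_rem _ j2) /= leq_addr.
move: h1; rewrite lamD; move: h2 Nn lamv.
move: (\sum_(_ <- J1) _)%N (\sum_(_ <- J2) _)%N (lam j) (lam v) => a b l k.
move=> h2 Nn k0 h1.
have : (n <= absz (n%:Z * k)%R)%N by rewrite abszM absz_nat leq_pmulr// absz_gt0.
move: h1; move: (n%:Z * k) => nk; lia.
Qed.

Lemma chi_ergodic x t A : (x, t) <> (0, 0) -> prod_sigma A ->
  st_shift x t @^-1` A = A ->
  P ((fun w sy => chi p xi sy.1 sy.2 w) @^-1` A) = 0%E \/
  P ((fun w sy => chi p xi sy.1 sy.2 w) @^-1` A) = 1%E.
Proof.
move=> xt0 /Phi_gen gA Ainv.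
have -> : (fun w sy => chi p xi sy.1 sy.2 w) @^-1` A = shifted X 0 @^-1` (Phi @^-1` A).
  by apply/seteqP; split => w /=; rewrite PhiE.
apply: (invariant_trivial mX iX lX (v := (t, x)) _ gA).
  apply: shift_escape; apply/eqP => -[t0 x0]; apply: xt0; by rewrite t0 x0.
(* Invariance under one shift extends to its multiples because [Phi] commutes with shifts. *)
move=> w n; elim: n => [|n IH]; first by rewrite mulr0n.
rewrite -IH mulrS -path_shift.
rewrite -[X in X <-> _]/(A (Phi (st_shift x t (shifted X ((t, x) *+ n) w)))) -Phi_shift.
by rewrite -[X in X <-> _]/((st_shift x t @^-1` A) _) Ainv.
Qed.

End StationarySolution.

(** * Characteristic functions and nonexistence of invariant laws *)

Section SineBounds.
Variable R : realType.

Lemma sin_mvt (y : R) : exists2 c, `|c| <= `|y| & sin y = y * cos c.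
Proof.
have pos (z : R) : 0 <= z -> exists2 c, `|c| <= `|z| & sin z = z * cos c.
  move=> z0.
  have cs : {within `[0, z], continuous (@sin R)}.
    by apply: continuous_subspaceT => x; exact: continuous_sin.
  have [c] := MVT_segment z0 (fun x _ => is_derive_sin x) cs.
  rewrite in_itv /= => /andP[c0 cz]; rewrite sin0 !subr0 mulrC => E; exists c => //.
  by rewrite !ger0_norm.
have [y0|/ltW y0] := leP 0 y; first exact: pos.
have [c cy E] := pos (- y) (ltac:(by rewrite oppr_ge0)).
exists c; first by rewrite -[ `|y| ]normrN.
by move: E; rewrite sinN mulNr => /oppr_inj.
Qed.

Lemma norm_sin_le (y : R) : `|sin y| <= `|y|.
Proof.
have [c _ ->] := sin_mvt y.
by rewrite normrM ler_piMr// cos_max.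
Qed.

Lemma norm_cosB1_le (y : R) : `|cos y - 1| <= `|y|.
Proof.
have pos (z : R) : 0 <= z -> `|cos z - 1| <= `|z|.
  move=> z0.
  have cc : {within `[0, z], continuous (@cos R)}.
    by apply: continuous_subspaceT => x; exact: continuous_cos.
  have [c] := MVT_segment z0 (fun x _ => is_derive_cos x) cc.
  by move=> _; rewrite cos0 !subr0 => ->; rewrite normrM normrN ler_piMl// sin_max.
have [y0|/ltW y0] := leP 0 y; first exact: pos.
by rewrite -cosN -[ `|y| ]normrN pos// oppr_ge0.
Qed.

Lemma sin_quotient (u a : R) : u != 0 -> `|sin (u * a) / u - a| <= a ^+ 2 * `|u|.
Proof.
move=> u0; have [c cua ->] := sin_mvt (u * a).
have -> : u * a * cos c / u - a = a * (cos c - 1) by field.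
rewrite normrM -(real_normK (num_real a)) expr2 -mulrA; apply: ler_wpM2l => //.
by apply: le_trans (norm_cosB1_le c) _; rewrite mulrC -normrM.
Qed.

End SineBounds.

(** * The squared modulus of a characteristic function *)

Section CharacteristicFunction.
Context (dO : measure_display) (Omega : measurableType dO) (R : realType)
  (P : probability Omega R).
Implicit Types X Y : Omega -> R.

Lemma Rintegral_dominated_cvg (f_ : nat -> Omega -> R) (f g : Omega -> R) :
  (forall n, measurable_fun setT (f_ n)) -> measurable_fun setT f ->
  P.-integrable setT (EFin \o g) ->
  (forall w, (fun n => f_ n w) @ \oo --> f w) ->
  (forall n w, `|f_ n w| <= g w) ->
  (fun n => \int[P]_w f_ n w) @ \oo --> \int[P]_w f w.
Proof.
move=> mf_ mf ig ff fg.
have [|||||i1 _ h] := @dominated_convergence _ _ _ P setT measurableT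
  (fun n => EFin \o f_ n) (EFin \o f) (EFin \o g).
- by move=> n; exact/measurable_EFinP.
- exact/measurable_EFinP.
- by apply: aeW => w _; apply: cvg_EFin; [exact: nearW|exact: ff].
- exact: ig.
- by apply: aeW => w n _; rewrite /= lee_fin.
apply: fine_cvg; rewrite fineK; first exact: h.
exact: integrable_fin_num.
Qed.

Lemma Rintegral_const (c : R) : \int[P]_w c = c.
Proof.
rewrite /Rintegral integral_cst//= [X in (_ * X)%E](_ : _ = 1%E) ?mule1//.
exact: probability_setT.
Qed.

Lemma bounded_integrable X : measurable_fun setT X -> (forall w, `|X w| <= 1) ->
  P.-integrable setT (EFin \o X).
Proof.
move=> mX X1; apply: (@le_integrable_EFin _ _ _ P X (fun=> 1)) => //.
exact: finite_measure_integrable_cst.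
Qed.

Lemma measurable_cos X : measurable_fun setT X -> measurable_fun setT (fun w => cos (X w)).
Proof.
move=> mX; apply: measurableT_comp mX.
by apply: continuous_measurable_fun; exact: continuous_cos.
Qed.

Lemma measurable_sin X : measurable_fun setT X -> measurable_fun setT (fun w => sin (X w)).
Proof.
move=> mX; apply: measurableT_comp mX.
by apply: continuous_measurable_fun; exact: continuous_sin.
Qed.

Lemma integrable_cos X : measurable_fun setT X ->
  P.-integrable setT (EFin \o (fun w => cos (X w))).
Proof.
by move=> mX; apply: bounded_integrable => [|w]; [exact: measurable_cos|exact: cos_max].
Qed.

Lemma integrable_sin X : measurable_fun setT X ->
  P.-integrable setT (EFin \o (fun w => sin (X w))).
Proof.
by move=> mX; apply: bounded_integrable => [|w]; [exact: measurable_sin|exact: sin_max].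
Qed.

(* [|E exp(i X)|^2], written without complex numbers. *)
Definition phi2 X : R := (\int[P]_w cos (X w)) ^+ 2 + (\int[P]_w sin (X w)) ^+ 2.

Lemma phi2_ge0 X : 0 <= phi2 X.
Proof. by rewrite addr_ge0// sqr_ge0. Qed.

Lemma phi2_same_law X Y : measurable_fun setT X -> measurable_fun setT Y ->
  (forall B, measurable B -> P (X @^-1` B) = P (Y @^-1` B)) -> phi2 X = phi2 Y.
Proof.
move=> mX mY XY; rewrite /phi2.
rewrite (@same_law_integral _ _ _ P X Y mX mY XY cos); last 2 first.
- by apply: continuous_measurable_fun; exact: continuous_cos.
- exact: integrable_cos.
rewrite (@same_law_integral _ _ _ P X Y mX mY XY sin)//.
- by apply: continuous_measurable_fun; exact: continuous_sin.
- exact: integrable_sin.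
Qed.

Let indep_comp X Y (f g : R -> R) : measurable_fun setT f -> measurable_fun setT g ->
  indep_rv P X Y -> indep_rv P (f \o X) (g \o Y).
Proof.
move=> mf mg XY A B mA mB; apply: (XY (f @^-1` A) (g @^-1` B)).
  by rewrite -[X in measurable X]setTI; exact: mf.
by rewrite -[X in measurable X]setTI; exact: mg.
Qed.

Let indep_mul X Y (f g : R -> R) : continuous f -> continuous g ->
  (forall x, `|f x| <= 1) -> (forall x, `|g x| <= 1) ->
  measurable_fun setT X -> measurable_fun setT Y -> indep_rv P X Y ->
  P.-integrable setT (EFin \o (fun w => f (X w) * g (Y w))) /\
  \int[P]_w (f (X w) * g (Y w)) = (\int[P]_w f (X w)) * (\int[P]_w g (Y w)).
Proof.
move=> cf cg f1 g1 mX mY XY.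
have mf := continuous_measurable_fun cf; have mg := continuous_measurable_fun cg.
have mfX : measurable_fun setT (f \o X) by exact: measurableT_comp.
have mgY : measurable_fun setT (g \o Y) by exact: measurableT_comp.
have ifX : P.-integrable setT (EFin \o (f \o X)).
  exact: (bounded_integrable mfX (fun w => f1 (X w))).
have igY : P.-integrable setT (EFin \o (g \o Y)).
  exact: (bounded_integrable mgY (fun w => g1 (Y w))).
have ind := indep_comp mf mg XY.
split; first exact: (integrable_indepM mfX mgY ind ifX igY).
rewrite /Rintegral (integral_indepM mfX mgY ind ifX igY) fineM//;
  exact: integrable_fin_num.
Qed.

Lemma phi2_indep X Y : measurable_fun setT X -> measurable_fun setT Y ->
  indep_rv P X Y -> phi2 (fun w => X w + Y w) = phi2 X * phi2 Y.
Proof.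
move=> mX mY XY.
have [icc cc] := indep_mul (@continuous_cos R) (@continuous_cos R) (@cos_max R) (@cos_max R) mX mY XY.
have [iss ss] := indep_mul (@continuous_sin R) (@continuous_sin R) (@sin_max R) (@sin_max R) mX mY XY.
have [isc sc] := indep_mul (@continuous_sin R) (@continuous_cos R) (@sin_max R) (@cos_max R) mX mY XY.
have [ics cs] := indep_mul (@continuous_cos R) (@continuous_sin R) (@cos_max R) (@sin_max R) mX mY XY.
rewrite /phi2.
under eq_Rintegral do rewrite cosD.
rewrite RintegralB//.
under [X in _ + X ^+ 2]eq_Rintegral do rewrite sinD.
rewrite RintegralD// cc ss sc cs; ring.
Qed.

Lemma Rintegral_sqr_le X : measurable_fun setT X -> (forall w, `|X w| <= 1) ->
  (\int[P]_w X w) ^+ 2 <= \int[P]_w (X w ^+ 2).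
Proof.
move=> mX X1; set m := \int[P]_w X w.
have iX := bounded_integrable mX X1.
have iX2 : P.-integrable setT (EFin \o (fun w => X w ^+ 2)).
  apply: bounded_integrable; first exact: measurable_funX.
  by move=> w; rewrite normrX -[leRHS](expr1n _ 2) lerXn2r// nnegrE.
have : 0 <= \int[P]_w ((X w - m) ^+ 2) by apply: Rintegral_ge0 => w _; exact: sqr_ge0.
have -> : \int[P]_w ((X w - m) ^+ 2) = \int[P]_w (X w ^+ 2 + (- (2 * m) * X w + m ^+ 2)).
  by apply: eq_Rintegral => w _; ring.
have ic : P.-integrable setT (EFin \o (fun=> m ^+ 2)) by exact: finite_measure_integrable_cst.
have iZ := integrable_EFinZ (- (2 * m)) iX.
rewrite RintegralD//; last exact: integrable_EFinD.
rewrite RintegralD// RintegralZl// Rintegral_const -/m.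
lra.
Qed.

(** Since (E cos X)^2 <= E cos^2 X = 1 - E sin^2 X, the defect 1 - |E exp(i X)|^2 is at least the
    variance of sin X. *)
Lemma phi2_var X : measurable_fun setT X ->
  phi2 X <= 1 - (\int[P]_w (sin (X w) ^+ 2) - (\int[P]_w sin (X w)) ^+ 2).
Proof.
move=> mX; rewrite /phi2.
have mc := measurable_cos mX; have ms := measurable_sin mX.
have c1 w : `|cos (X w)| <= 1 by exact: cos_max.
have s1 w : `|sin (X w)| <= 1 by exact: sin_max.
have := Rintegral_sqr_le mc c1.
have i1 : P.-integrable setT (EFin \o (fun=> 1 : R)) by exact: finite_measure_integrable_cst.
have is2 : P.-integrable setT (EFin \o (fun w => sin (X w) ^+ 2)).
  apply: bounded_integrable; first exact: measurable_funX.
  by move=> w; rewrite normrX -[leRHS](expr1n _ 2) lerXn2r// nnegrE.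
have -> : \int[P]_w (cos (X w) ^+ 2) = 1 - \int[P]_w (sin (X w) ^+ 2).
  under eq_Rintegral do rewrite cos2sin2.
  by rewrite RintegralB// Rintegral_const.
lra.
Qed.

(** With second moments only, there is no rate at hand. A sequence of counterexamples u_n tending to
    0 is excluded because the variance of sin(u_n X) / u_n tends to that of X, and so exceeds half
    of it eventually. *)
Lemma phi2_quadratic X : sqint P X -> \int[P]_w X w = 0 -> 0 < \int[P]_w (X w ^+ 2) ->
  exists c u0, [/\ 0 < c, 0 < u0 & forall u, `|u| <= u0 ->
    phi2 (fun w => u * X w) <= 1 - c * u ^+ 2].
Proof.
move=> [mX iX2] X0 v0; set v := \int[P]_w _ in v0.
exists (v / 2); apply: contrapT => no.
have bad n : exists u : R, `|u| <= n.+1%:R^-1 /\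
    1 - v / 2 * u ^+ 2 < phi2 (fun w => u * X w).
  apply: contrapT => h; apply: no; exists n.+1%:R^-1; split.
  - by rewrite divr_gt0.
  - by rewrite invr_gt0.
  - move=> u un; rewrite leNgt; apply/negP => hu; apply: h; by exists u.
have /choice [u uP] := bad.
(* At u = 0 both sides equal 1, so 0 is no counterexample and division by [u n] is legitimate. *)
have u_neq0 n : u n != 0.
  apply/negP => /eqP un0; have [_] := uP n; rewrite un0 expr0n /= mulr0 subr0.
  rewrite /phi2; under eq_Rintegral do rewrite mul0r cos0.
  under [X in _ + X ^+ 2]eq_Rintegral do rewrite mul0r sin0.
  by rewrite !Rintegral_const expr0n addr0 expr1n ltxx.
have iX := sqint_integrable (conj mX iX2).
pose g n w := sin (u n * X w) / u n.
have muX n : measurable_fun setT (fun w => u n * X w) by exact: measurable_funM.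
have mg n : measurable_fun setT (g n).
  by apply: measurable_funM => //; exact: measurable_sin.
have gX n w : `|g n w| <= `|X w|.
  rewrite /g normrM normfV ler_pdivrMr ?normr_gt0// mulrC -normrM.
  exact: norm_sin_le.
have g_cvg w : (fun n => g n w) @ \oo --> X w.
  apply/cvgrPdist_le => e e0.
  have [N HN] : exists N : nat, X w ^+ 2 / N.+1%:R <= e.
    exists (Num.truncn (X w ^+ 2 / e)); rewrite ler_pdivrMr// mulrC -ler_pdivrMr//.
    by apply/ltW/truncnS_gt.
  exists N => // n /= Nn; rewrite distrC; apply: le_trans (sin_quotient _ (u_neq0 n)) _.
  apply: le_trans HN; apply: ler_wpM2l; first exact: sqr_ge0.
  apply: (le_trans (proj1 (uP n))); rewrite lef_pV2 ?posrE// ler_nat; exact: leq_ltn_trans Nn _.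
have h1 : (fun n => \int[P]_w g n w) @ \oo --> (0 : R).
  rewrite -X0; apply: (@Rintegral_dominated_cvg g X (fun w => `|X w|)) => //.
  exact: integrable_norm iX.
have h2 : (fun n => \int[P]_w (g n w ^+ 2)) @ \oo --> v.
  apply: (@Rintegral_dominated_cvg (fun n w => g n w ^+ 2) (fun w => X w ^+ 2) (fun w => X w ^+ 2)) => //.
  - by move=> n; exact: measurable_funX.
  - exact: measurable_funX.
  - by move=> w; rewrite expr2; under eq_fun do rewrite expr2; exact: cvgM.
  - move=> n w; rewrite normrX -(real_normK (num_real (X w))) lerXn2r// nnegrE//.
have h3 : (fun n => \int[P]_w (g n w ^+ 2) - (\int[P]_w g n w) ^+ 2) @ \oo --> v - 0 * 0.
  by apply: cvgB => //; under eq_fun do rewrite expr2; exact: cvgM.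
move: h3; rewrite mul0r subr0 => /cvgr_gt /(_ (v / 2)).
have v2 : v / 2 < v by rewrite gtr_pMr// invf_lt1// ltr1n.
move=> /(_ v2) [N _ /(_ N (leqnn N)) /= hN].
have [_ hu] := uP N.
have := phi2_var (muX N).
have -> : \int[P]_w (sin (u N * X w) ^+ 2) = u N ^+ 2 * \int[P]_w (g N w ^+ 2).
  rewrite -RintegralZl//; last first.
    apply: (@le_integrable_EFin _ _ _ P _ (fun w => X w ^+ 2)) => //; first exact: measurable_funX.
    by move=> w; rewrite normrX -(real_normK (num_real (X w))) lerXn2r// nnegrE.
  by apply: eq_Rintegral => w _; rewrite /g; field.
have -> : \int[P]_w sin (u N * X w) = u N * \int[P]_w g N w.
  rewrite -RintegralZl//; last first.
    by apply: (@le_integrable_EFin _ _ _ P _ (fun w => `|X w|)) => //; exact: integrable_norm iX.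
  by apply: eq_Rintegral => w _; rewrite /g; field.
have u20 : 0 < u N ^+ 2 by rewrite exprn_even_gt0//= u_neq0.
move: hN; rewrite -(ltr_pM2l u20) mulrBr exprMn => hN.
move: hu; rewrite (mulrC (v / 2)); lra.
Qed.

Lemma phi2_continuous0 X : measurable_fun setT X ->
  ~ (exists2 u0, 0 < u0 & forall u, 0 < u -> u <= u0 -> phi2 (fun w => u * X w) = 0).
Proof.
move=> mX [u0 u0_gt0 H].
pose u n : R := u0 / n.+1%:R.
have : (fun n => \int[P]_w cos (u n * X w)) @ \oo --> \int[P]_w (1 : R).
  apply: (@Rintegral_dominated_cvg _ (fun=> 1) (fun=> 1)) => //.
  - by move=> n; apply: measurable_cos; exact: measurable_funM.
  - exact: finite_measure_integrable_cst.
  - move=> w; rewrite -cos0; apply: (@cvg_comp _ _ _ _ cos); last exact: continuous_cos.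
    rewrite -(mul0r (X w)); apply: cvgMr_tmp; rewrite -(mulr0 u0); apply: cvgMl_tmp.
    exact: cvg_harmonic.
  - by move=> n w; exact: cos_max.
rewrite Rintegral_const => /cvgr_gt /(_ 0 ltr01) [N _ /(_ N (leqnn N)) /= h].
have uN : 0 < u N by rewrite divr_gt0.
have uN' : u N <= u0 by rewrite ler_pdivrMr//; apply: ler_peMr; [exact: ltW|rewrite ler1n].
have := H _ uN uN'; rewrite /phi2 => /eqP; rewrite paddr_eq0 ?sqr_ge0// sqrf_eq0.
by move=> /andP[/eqP E _]; move: h; rewrite E ltxx.
Qed.

End CharacteristicFunction.

(** * Contradiction between invariance and a divergent collision sum *)

Section NoInvariantLaw.
Variables (R : realType) (d : nat) (p : 'rV[int]_d -> R).
Notation Zd := 'rV[int]_d.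
Variable s : seq Zd.
Hypothesis s_uniq : uniq s.
Hypothesis s_supp : forall x, p x != 0 -> x \in s.
Hypothesis p_ge0 : forall x, 0 <= p x.
Hypothesis p_sum1 : \sum_(x <- s) p x = 1.
Hypothesis collision_div : forall C, exists n, C <= \sum_(k < n) collision p k.

Context (dO : measure_display) (Omega : measurableType dO)
  (P : probability Omega R) (xi h0 : Zd -> Omega -> R).
Hypothesis xi_iid : iid P xi.
Hypothesis xi_mean : ('E_P[xi 0%R] = 0)%E.
Hypothesis xi_sq : xi 0 \in Lfun P 2%:E.
Hypothesis xi_var : (0 < 'V_P[xi 0%R])%E.
Hypothesis h0_meas : forall x, measurable_fun setT (h0 x).
Hypothesis h0_indep : indep2 P (gen_sigma h0 setT) (gen_sigma xi setT).
Hypothesis h0_invariant : forall A : set (Zd -> R), prod_sigma A ->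
  P ((fun w x => avg p (fun y => h0 y w) x + xi x w) @^-1` A)
  = P ((fun w x => h0 x w) @^-1` A).

Let mxi x : measurable_fun setT (xi x). Proof. by case: xi_iid. Qed.
Let ixi : indep_family P (fun x => gen_sigma xi [set x]). Proof. by case: xi_iid. Qed.
Let lxi x y B : measurable B -> P (xi x @^-1` B) = P (xi y @^-1` B).
Proof. by case: xi_iid => _ _; apply. Qed.

Let xi0_sq : sqint P (xi 0).
Proof. by split=> //; exact: Lfun2_integrable_sqr. Qed.

Let xi0_mean : \int[P]_w xi 0 w = 0.
Proof. by have := xi_mean; rewrite unlock /Rintegral /= => ->. Qed.

Let xi0_var : 0 < \int[P]_w (xi 0 w ^+ 2).
Proof.
have := xi_var; rewrite varianceE// xi_mean expe2 mule0 sube0.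
rewrite unlock /= -(@fineK _ (\int[P]_w _)%E) ?lte_fin//.
by apply: integrable_fin_num => //; case: xi0_sq.
Qed.

Let gen (X : Zd -> Omega -> R) (S : set Zd) : set (set Omega) :=
  \bigcup_(i in S) [set X i @^-1` B | B in [set B : set R | measurable B]].

Let gen_meas X S i : S i -> measurable_fun [set: g_sigma_algebraType (gen X S)] (X i).
Proof. by move=> Si _ B mB; rewrite setTI; exact: gen_sigmaP. Qed.

Lemma phi2_sum (r : seq Zd) (c : Zd -> R) : uniq r ->
  phi2 P (fun w => \sum_(z <- r) c z * xi z w) =
  \prod_(z <- r) phi2 P (fun w => c z * xi 0 w).
Proof.
elim: r => [_|z r IH /= /andP[zr ur]].
  rewrite big_nil; rewrite /phi2.
  under eq_Rintegral do rewrite big_nil cos0.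
  under [X in _ + X ^+ 2]eq_Rintegral do rewrite big_nil sin0.
  by rewrite !Rintegral_const expr0n addr0 expr1n.
have mcx z' : measurable_fun setT (fun w => c z' * xi z' w) by exact: measurable_funM.
have mS : measurable_fun setT (fun w => \sum_(z <- r) c z * xi z w).
  by apply: measurable_sum => z'.
have E : phi2 P (fun w => c z * xi 0 w) = phi2 P (fun w => c z * xi z w).
  apply: phi2_same_law; [exact: measurable_funM|exact: mcx|move=> B mB].
  have mB' : measurable ((fun x => c z * x) @^-1` B).
    by rewrite -[X in measurable X]setTI; apply: measurable_funM.
  exact: (lxi 0 z mB').
rewrite big_cons -IH// E.
rewrite -phi2_indep//.
  by congr phi2; apply/funext => w; rewrite big_cons.
move=> A B mA mB.
apply: (indep_disjoint mxi ixi (S := [set z]) (T := [set` r])).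
- by rewrite -subset0 => y [/= -> yr]; rewrite yr in zr.
- apply: (@filt_preimage _ _ _ (gen xi [set z])) mA.
  by apply: measurable_funM => //; exact: gen_meas.
- apply: (@filt_preimage _ _ _ (gen xi [set` r])) mB.
  (* The test [y \in r] makes each summand measurable for the noise indexed by [r], whatever y. *)
  rewrite (_ : (fun w => _) = (fun w => \sum_(y <- r) if y \in r then c y * xi y w else 0));
    last by apply/funext => w; rewrite big_seq big_mkcond.
  apply: measurable_sum => y; have [yr|_] := boolP (y \in r); last exact: measurable_cst.
  by apply: measurable_funM => //; exact: gen_meas.
Qed.

Let L k (g : Zd -> R) := iter k (avg p) g 0.

Let measurable_L (u : R) k (X : Zd -> Omega -> R) :
  measurable_fun [set: g_sigma_algebraType (gen X setT)] (fun w => u * L k (fun x => X x w)).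
Proof.
apply: measurable_funM => //.
apply: (@measurable_iter_avg _ _ _ _ s_uniq s_supp _ (g_sigma_algebraType (gen X setT)) X).
by move=> z; exact: gen_meas.
Qed.

Let mL (u : R) k (X : Zd -> Omega -> R) : (forall x, measurable_fun setT (X x)) ->
  measurable_fun setT (fun w => u * L k (fun x => X x w)).
Proof.
move=> mX; apply: measurable_funM => //.
exact: (measurable_iter_avg s_uniq s_supp).
Qed.

Let pk_le1 k z : pk p k 0 z <= 1.
Proof.
rewrite -(pk_sum1 s_uniq s_supp p_sum1 k 0).
have := @ler_sum_fsum _ _ [:: z] (pk p k 0) isT (pk_fin s_uniq s_supp k 0)
  (pk_ge0 s_uniq s_supp p_ge0 k 0).
by rewrite big_seq1.
Qed.

Let iter_avgD k F G x : iter k (avg p) (fun z => F z + G z) x =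
  iter k (avg p) F x + iter k (avg p) G x.
Proof.
elim: k x => [|k IH] x//; rewrite !iterS !(avgE s_uniq s_supp) -big_split.
by apply: eq_bigr => z _; rewrite IH mulrDr.
Qed.

(** Invariance is applied to the functional [u * L k], replacing h by one step of the evolution.
    Thus a single noise field independent of h serves at every k, and the recursion takes place on
    numbers. *)
Lemma phi2_step u k : phi2 P (fun w => u * L k (fun x => h0 x w)) =
  phi2 P (fun w => u * L k.+1 (fun x => h0 x w)) *
  phi2 P (fun w => u * L k (fun x => xi x w)).
Proof.
pose h1 x w := avg p (fun y => h0 y w) x + xi x w.
have mh1 x : measurable_fun setT (h1 x).
  apply: measurable_funD => //; exact: (@measurable_iter_avg _ _ _ _ s_uniq s_supp _ _ h0 1).
rewrite -(@phi2_same_law _ _ _ P (fun w => u * L k (fun x => h1 x w))); last 3 first.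
- exact: mL.
- exact: mL.
- move=> B mB.
  pose D : set (set (Zd -> R)) := \bigcup_(i in [set: Zd])
    [set (fun f : Zd -> R => f i) @^-1` B | B in [set B : set R | measurable B]].
  apply: (h0_invariant (A := (fun g => u * L k g) @^-1` B)).
  have mLc : measurable_fun [set: g_sigma_algebraType D] (fun g => u * L k g).
    apply: measurable_funM => //.
    apply: (@measurable_iter_avg _ _ _ _ s_uniq s_supp _ (g_sigma_algebraType D) (fun z g => g z)) => z.
    move=> _ B' mB'; rewrite setTI.
    exact: (@gen_sigmaP _ _ _ (fun (i : Zd) (f : Zd -> R) => f i) setT z).
  by have := mLc measurableT B mB; rewrite setTI.
rewrite -phi2_indep; [|exact: mL|exact: mL|].
  congr phi2; apply/funext => w.
  by rewrite /L /h1 iter_avgD mulrDr iterSr.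
move=> A B mA mB; apply: h0_indep.
- exact: (filt_preimage (@measurable_L u k.+1 h0) mA).
- exact: (filt_preimage (@measurable_L u k xi) mB).
Qed.

(** The weights p^k(0, z) lie in [0, 1], so every u p^k(0, z) stays in the range of the quadratic
    bound; then 1 - x <= exp(- x) turns the product over z into a sum of squares. *)
Lemma phi2_noise (c u0 u : R) k : 0 <= c -> `|u| <= u0 ->
  (forall v, `|v| <= u0 -> phi2 P (fun w => v * xi 0 w) <= 1 - c * v ^+ 2) ->
  phi2 P (fun w => u * L k (fun x => xi x w)) <= expR (- (c * u ^+ 2 * collision p k)).
Proof.
move=> c0 uu0 H.
have [r0 r0P] := pk_fin s_uniq s_supp k 0.
have ur := undup_uniq r0.
have -> : (fun w => u * L k (fun x => xi x w)) =
    (fun w => \sum_(z <- undup r0) (u * pk p k 0 z) * xi z w).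
  apply/funext => w; rewrite /L -(fsum_pk s_uniq s_supp) (@fsum_seq _ _ (undup r0))//.
    by rewrite mulr_sumr; apply: eq_bigr => z _; rewrite -mulrA (mulrC (xi z w)).
  move=> z; apply: contraNT; rewrite mem_undup => zr.
  have /eqP -> : pk p k 0 z == 0 by apply: contraNT zr => /r0P.
  by rewrite mulr0.
rewrite phi2_sum//.
have -> : collision p k = \sum_(z <- undup r0) pk p k 0 z ^+ 2.
  rewrite /collision (@fsum_seq _ _ (undup r0))// => z; rewrite mem_undup => z0.
  by apply: r0P; apply: contra z0 => /eqP ->; rewrite expr0n.
rewrite mulr_sumr -sumrN expR_sum; apply: ler_prod => z _; rewrite phi2_ge0 /=.
have w0 := pk_ge0 s_uniq s_supp p_ge0 k 0 z.
apply: le_trans (H _ _) _.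
  rewrite normrM (ger0_norm w0); apply: le_trans uu0.
  by rewrite ler_piMr.
by rewrite exprMn mulrA; apply: le_trans (expR_ge1Dx _).
Qed.

Lemma no_invariant_law : False.
Proof.
have [c [u0 [c0 u00 H]]] := phi2_quadratic xi0_sq xi0_mean xi0_var.
apply: (@phi2_continuous0 _ _ _ P _ (@h0_meas 0)); exists u0 => // u u_gt0 uu0.
have nu : `|u| <= u0 by rewrite gtr0_norm.
have key n : phi2 P (fun w => u * h0 0 w) <= expR (- (c * u ^+ 2 * \sum_(k < n) collision p k)).
  have : phi2 P (fun w => u * h0 0 w) <=
     phi2 P (fun w => u * L n (fun x => h0 x w)) * expR (- (c * u ^+ 2 * \sum_(k < n) collision p k)).
    elim: n => [|n IH]; first by rewrite big_ord0 mulr0 oppr0 expR0 mulr1.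
    apply: (le_trans IH); rewrite phi2_step big_ord_recr /= (mulrDr (c * u ^+ 2)) opprD expRD.
    rewrite -mulrA; apply: ler_wpM2l; first exact: phi2_ge0.
    rewrite mulrC; apply: ler_wpM2l; first exact: expR_ge0.
    exact: phi2_noise (ltW c0) nu H.
  (* The factor of P^n h is bounded by 1. *)
  move=> /le_trans; apply; rewrite ler_piMl ?expR_ge0//.
  apply: le_trans (phi2_var P _) _; first exact: mL.
  rewrite gerBl subr_ge0; apply: Rintegral_sqr_le => [|w].
    by apply: measurable_sin; exact: mL.
  exact: sin_max.
apply/eqP; rewrite eq_le phi2_ge0 andbT; apply/ler_addgt0Pr => e e0; rewrite add0r.
have cu : 0 < c * u ^+ 2 by rewrite mulr_gt0// exprn_gt0.
(* Makes the exponent at least 1 / e in absolute value, so that the exponential is at most 1 / (1 +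
   1 / e) <= e. *)
have [n Hn] := collision_div (e^-1 / (c * u ^+ 2)).
apply: (le_trans (key n)); rewrite expRN invf_ple ?posrE ?expR_gt0//.
apply: le_trans (expR_ge1Dx _); rewrite ler_wpDl//.
by move: Hn; rewrite ler_pdivrMr// mulrC.
Qed.

End NoInvariantLaw.

Theorem theorem2p7 (R : realType) (d : nat) (p : 'rV[int]_d -> R)
  (p_range : forall x, 0 <= p x < 1)
  (p_sum : \sum_(x \in [set: 'rV[int]_d]) p x = 1)
  (p_fin : exists M : nat, forall x, norm_gt M x -> p x = 0)
  (p_aper : strongly_aperiodic p) :
  (* (a) d = 1, 2: no invariant distribution *)
  ((d = 1%N \/ d = 2%N) ->
   forall (dO : measure_display) (Omega : measurableType dO)
     (P : probability Omega R)
     (xi : 'rV[int]_d -> Omega -> R) (h0 : 'rV[int]_d -> Omega -> R),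
     iid P xi ->
     ('E_P[xi 0%R] = 0)%E ->
     xi 0 \in Lfun P 2%:E ->
     (0 < 'V_P[xi 0%R])%E ->
     (forall x, measurable_fun setT (h0 x)) ->
     indep2 P (gen_sigma h0 setT) (gen_sigma xi setT) ->
     ~ (forall A : set ('rV[int]_d -> R), prod_sigma A ->
          P ((fun w x => avg p (fun y => h0 y w) x + xi x w) @^-1` A)
          = P ((fun w x => h0 x w) @^-1` A)))
  /\
  (* (b) d >= 3: the stationary solution chi *)
  ((3 <= d)%N ->
   forall (dO : measure_display) (Omega : measurableType dO)
     (P : probability Omega R)
     (xi : int -> 'rV[int]_d -> Omega -> R),
     iid P (fun tx : int * 'rV[int]_d => xi tx.1 tx.2) ->
     ('E_P[xi 0%R 0%R] = 0)%E ->
     xi 0 0 \in Lfun P 2%:E ->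
     [/\
       (* a.s. convergence of the series *)
       {ae P, forall w, forall (t : int) (x : 'rV[int]_d),
           cvgn (fun n => Spart p xi n t x w)},
       (* L^2 convergence *)
       (forall (t : int) (x : 'rV[int]_d),
          (fun n => (\int[P]_w ((Spart p xi n t x w - chi p xi t x w) ^+ 2)%:E)%E)
            @ \oo --> 0%E),
       (* a.s. the recursion holds for all t, x *)
       {ae P, forall w, forall (t : int) (x : 'rV[int]_d),
           chi p xi (t + 1) x w = avg p (fun y => chi p xi t y w) x + xi (t + 1) x w},
       (* Markov property: xi_{t+1} independent of (chi_s)_{s <= t} *)
       (forall t : int,
          indep2 P (gen_sigma (fun sy : int * 'rV[int]_d => chi p xi sy.1 sy.2)
                              [set sy | (sy.1 <= t)%R])
                   (gen_sigma (xi (t + 1)) setT)) &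
       (* invariance (in particular stationarity, (x,t) = (0,1)) and
          ergodicity of the field under each shift theta_{x,t}, (x,t) <> (0,0) *)
       (forall (x : 'rV[int]_d) (t : int), (x, t) <> (0, 0) ->
          (forall A : set (int * 'rV[int]_d -> R), prod_sigma A ->
             P ((fun w sy => chi p xi sy.1 sy.2 w) @^-1` (st_shift x t @^-1` A))
             = P ((fun w sy => chi p xi sy.1 sy.2 w) @^-1` A)) /\
          (forall A : set (int * 'rV[int]_d -> R), prod_sigma A ->
             st_shift x t @^-1` A = A ->
             P ((fun w sy => chi p xi sy.1 sy.2 w) @^-1` A) = 0%E \/
             P ((fun w sy => chi p xi sy.1 sy.2 w) @^-1` A) = 1%E))]).
Proof.
have p_ge0 x : 0 <= p x by case/andP: (p_range x).
have [s s_uniq s_supp] : exists2 s : seq 'rV[int]_d, uniq s &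
    forall x, p x != 0 -> x \in s.
  have [M pM] := p_fin; exists (box M 0); first exact: box_uniq.
  move=> x px; apply: mem_box => i; rewrite mxE subr0 leNgt.
  by apply/negP => xi; move/eqP: px; apply; apply: pM; exists i.
have p_sum1 : \sum_(x <- s) p x = 1 by rewrite -(fsum_seq s_uniq s_supp).
split=> [d12|d3] dO Omega P xi.
  move=> h0 xi_iid xi_mean xi_sq xi_var h0_meas h0_indep h0_inv.
  have d2 : (d <= 2)%N by case: d12 => ->.
  exact: (no_invariant_law s_uniq s_supp p_ge0 p_sum1
    (collision_unbounded s_uniq s_supp p_ge0 p_sum1 d2) xi_iid xi_mean xi_sq xi_var
    h0_meas h0_indep h0_inv).
move=> xi_iid xi_mean xi_sq.
have [V qV] := collision_bounded s_uniq s_supp p_ge0 p_sum1 p_aper d3.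
have cvg_ae := chi_ae_cvg s_uniq s_supp qV xi_iid xi_mean xi_sq.
split.
- exact: cvg_ae.
- by move=> t x; exact: (chi_series_L2 s_uniq s_supp qV xi_iid xi_mean xi_sq).
- apply: filterS cvg_ae => w; exact: (chi_recursion s_uniq s_supp).
- by move=> t; exact: (chi_markov s_uniq s_supp xi_iid).
- move=> x t xt; split=> A gA; first exact: (chi_invariant s_uniq s_supp xi_iid).
  by move=> Ainv; exact: (chi_ergodic s_uniq s_supp xi_iid xi_sq xt).
Qed.
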